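(* Let $L>0$, $0\le v<1$, $\eta=0$, and let $\phi^0\in\mathcal H_L(\mathbf I_0)$ and $\phi^1\in L^2(\mathbf I_0)$. Let $\phi$ be the solution of Problem (WP) with $\eta=0$, and let $(a_n)_{n\in\mathbb Z}$ be its coefficients. Then the functional $$\mathcal E_v(t)=\frac12\int_{\mathbf I_t}\left(\phi_t+v\phi_x\right)^2+(1-v^2)\phi_x^2\,dx$$ satisfies $$\mathcal E_v(t)=\frac{\pi^2(1-v^2)}{2L}\sum_{n\in\mathbb Z}\left|(2n+1)a_n\right|^2,\qquad\text{for } t\ge0,$$ where the left-hand side is independent of $t$.
   Context: Setting. $L>0$ is the length of the string and $0\le v<1$ its speed; there is no damping ($\eta=0$). For $t\ge 0$ let $\mathbf I_t:=(vt,L+vt)$, so $\mathbf I_0=(0,L)$. Subscripts $x,t$ denote partial derivatives. Functions $\phi^0,\phi^1,\phi$ are real-valued. Problem (WP) with $\eta=0$: - $\phi_{tt}-\phi_{xx}=0$ for $x\in\mathbf I_t$, $t>0$; - $\phi_x(vt,t)+v\,\phi_t(vt,t)=0$ for $t>0$; - $\phi(L+vt,t)=0$ for $t>0$; - $\phi(x,0)=\phi^0(x)$, $\phi_t(x,0)=\phi^1(x)$ for $x\in\mathbf I_0$. Function space: $\mathcal H_{L+vt}(\mathbf I_t):=\{w\in H^1(\mathbf I_t): w(L+vt)=0\}$; in particular $\mathcal H_L(\mathbf I_0)=\{w\in H^1(0,L): w(L)=0\}$. The solution $\phi$ lies in $C([0,T];\mathcal H_{L+vt}(\mathbf I_t))\cap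 C^1([0,T];L^2(\mathbf I_t))$ for $T>0$ and is given, with $\omega_n=\frac{(2n+1)i\pi}{2}$, by $$\phi(x,t)=\sum_{n\in\mathbb Z}a_n\left(e^{\frac{1-v}{L}\omega_n(t+x)}+e^{\frac{1+v}{L}\omega_n(t-x)}\right),\quad x\in\mathbf I_t,\ t\ge0,$$ with coefficients $$a_n=\frac{1}{4\omega_n}\int_0^{L_2}\left(\tilde\phi^0_x+\tilde\phi^1\right)e^{-\frac{1-v}{L}\omega_n x}\,dx,\qquad L_2:=\frac{2L}{1-v}.$$ Here, with $\gamma_v:=\frac{1+v}{1-v}$, the extensions to $(0,L_2)$ are: $\tilde\phi^0_x(x)=\phi^0_x(x)$, $\tilde\phi^1(x)=\phi^1(x)$ for $x\in(0,L)$, and, for $x\in(L,L_2)$, $$\tilde\phi^0_x(x)=\frac1{\gamma_v}\phi^0_x\left(-\frac{x}{\gamma_v}+\frac{2L}{1+v}\right),\qquad \tilde\phi^1(x)=-\frac1{\gamma_v}\phi^1\left(-\frac{x}{\gamma_v}+\frac{2L}{1+v}\right).$$ *)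

(* Defs.v *)
From HB Require Import structures.
From mathcomp Require Import all_boot all_order all_algebra.
From mathcomp Require Import all_classical all_reals all_analysis.
From mathcomp Require Import complex.
Set Implicit Arguments.
Unset Strict Implicit.
Unset Printing Implicit Defensive.
Import Order.TTheory GRing.Theory Num.Theory.
Import numFieldNormedType.Exports.
Local Open Scope classical_set_scope.
Local Open Scope ring_scope.

Section Sobolev.
Variable R : realType.
Notation mu := (@lebesgue_measure R).

Definition L2_on (D : set R) (f : R -> R) : Prop :=
  measurable_fun D f /\ mu.-integrable D (fun x => (f x ^+ 2)%:E).

Definition sqdist_L2 (a b : R) (f g : R -> R) : \bar R :=
  (\int[mu]_(x in `]a, b[) ((f x - g x) ^+ 2)%:E)%E.

Definition C1c (a b : R) (psi : R -> R) : Prop :=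
  [/\ forall x : R, derivable psi x 1,
      continuous (derive1 psi) &
      exists c d : R, [/\ a < c, c <= d, d < b &
        forall x, ~ (c <= x <= d) -> psi x = 0]].

Definition weak_derivative (a b : R) (w w' : R -> R) : Prop :=
  forall psi : R -> R, C1c a b psi ->
    \int[mu]_(x in `]a, b[) (w x * derive1 psi x) =
    - \int[mu]_(x in `]a, b[) (w' x * psi x).

(* w is the continuous representative, on [a, b], of an element of H^1(a, b),
   and w' is (a representative of) its weak derivative; in particular the trace
   of this element at an endpoint is a value of w. *)
Definition H1_on (a b : R) (w w' : R -> R) : Prop :=
  [/\ {within `[a, b], continuous w},
      L2_on `]a, b[ w, L2_on `]a, b[ w' & weak_derivative a b w w'].

(* Elements of H^1(a, b) that vanish at the right endpoint b. *)
Definition H1_right (a b : R) (w w' : R -> R) : Prop :=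
  H1_on a b w w' /\ w b = 0.

End Sobolev.

Section MovingString.
Variable R : realType.
Notation mu := (@lebesgue_measure R).

Definition I_ (L v t : R) : set R := `]v * t, L + v * t[.

(* The slice at time t of a function of (x, t), transported from I_ L v t to
   the fixed interval ]0, L[. *)
Definition slice (v : R) (f : R -> R -> R) (t : R) : R -> R :=
  fun y => f (y + v * t) t.

Definition pdx (psi : R -> R -> R) (x t : R) : R := derive1 (psi^~ t) x.
Definition pdt (psi : R -> R -> R) (x t : R) : R := derive1 (psi x) t.

Definition C1_2 (psi : R -> R -> R) : Prop :=
  [/\ forall x t : R, derivable (psi^~ t) x 1,
      forall x t : R, derivable (psi x) t 1,
      continuous (fun z : R * R => pdx psi z.1 z.2) &
      continuous (fun z : R * R => pdt psi z.1 z.2)].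

(* Compact support in time inside ]0, +oo[; psi vanishes at the Dirichlet end
   x = L + v t but is free at the other end x = v t. *)
Definition test_fun (L v : R) (psi : R -> R -> R) : Prop :=
  [/\ C1_2 psi,
      forall t, psi (L + v * t) t = 0 &
      exists t1 t2 : R, [/\ 0 < t1, t1 <= t2 &
        forall x t, ~ (t1 <= t <= t2) -> psi x t = 0]].

(* phi in C([0, +oo[; H^1(I_t)) with weak x-derivative phix. *)
Definition continuous_in_H1 (L v : R) (phi phix : R -> R -> R) : Prop :=
  forall t : R, 0 <= t ->
    adde (sqdist_L2 0 L (slice v phi s) (slice v phi t))
         (sqdist_L2 0 L (slice v phix s) (slice v phix t))
      @[s --> within [set s | 0 <= s] (nbhs t)] --> 0%E.

(* phi in C^1([0, +oo[; L^2(I_t)).  In the frame of the string, t |-> slice v phi t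
   has the L^2(0, L)-valued derivative slice v (phi_t + v phi_x), by the chain
   rule; since phix is continuous in time with values in L^2, continuity of
   this derivative amounts to that of phit. *)
Definition C1_in_L2 (L v : R) (phi phix phit : R -> R -> R) : Prop :=
  let Dphi := fun x t => phit x t + v * phix x t in
  forall t : R, 0 <= t ->
    [/\ L2_on (I_ L v t) (phit^~ t),
        sqdist_L2 0 L
          (fun y => (slice v phi (t + h) y - slice v phi t y) / h)
          (slice v Dphi t)
          @[h --> within [set h | 0 <= t + h] 0^'] --> 0%E &
        sqdist_L2 0 L (slice v Dphi s) (slice v Dphi t)
          @[s --> within [set s | 0 <= s] (nbhs t)] --> 0%E].

(* Finite-energy solutions of
     phi_tt - phi_xx = 0 in I_t,  phi_x + v phi_t = 0 at x = v t,
     phi = 0 at x = L + v t,  phi = phi0 and phi_t = phi1 at t = 0.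
   The derivatives of phi have no trace at x = v t, so the wave equation and
   the boundary condition there are imposed together, in variational form: by
   Green's formula on {(x, t) | t > 0, x in I_t}, for smooth phi,
     - \iint (phi_t psi_t - phi_x psi_x) dx dt
       = \iint (phi_tt - phi_xx) psi dx dt
         + \int (phi_x + v phi_t) psi (v t, t) dt
   for every test function psi. *)
Record WP_solution (L v : R) (phi0 phi1 : R -> R)
    (phi phix phit : R -> R -> R) : Prop := {
  WP_H1 : forall t : R, 0 <= t ->
    H1_right (v * t) (L + v * t) (phi^~ t) (phix^~ t);
  WP_continuous : continuous_in_H1 L v phi phix;
  WP_C1 : C1_in_L2 L v phi phix phit;
  WP_wave : forall psi, test_fun L v psi ->
    \int[mu]_(t in `]0, +oo[) \int[mu]_(x in I_ L v t)
      (phit x t * pdt psi x t - phix x t * pdx psi x t) = 0;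
  WP_init0 : forall x, I_ L v 0 x -> phi x 0 = phi0 x;
  WP_init1 : {ae mu, forall x, I_ L v 0 x -> phit x 0 = phi1 x}
}.

Definition energy (L v : R) (phix phit : R -> R -> R) (t : R) : \bar R :=
  ((2^-1)%:E * \int[mu]_(x in I_ L v t)
     ((phit x t + v * phix x t) ^+ 2 + (1 - v ^+ 2) * phix x t ^+ 2)%:E)%E.

End MovingString.

Section Coefficients.
Variable R : realType.
Notation mu := (@lebesgue_measure R).
Local Open Scope complex_scope.

Definition cexp (z : R[i]) : R[i] :=
  (expR (complex.Re z))%:C * (cos (complex.Im z) +i* sin (complex.Im z)).

Definition Cintegral (D : set R) (f : R -> R[i]) : R[i] :=
  (\int[mu]_(x in D) complex.Re (f x)) +i*
  (\int[mu]_(x in D) complex.Im (f x)).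

Definition omega (n : int) : R[i] :=
  (2 * n + 1)%:~R * (0 +i* 1) * (pi : R)%:C / 2.

Definition gamma_ (v : R) : R := (1 + v) / (1 - v).

Definition L_2 (L v : R) : R := 2 * L / (1 - v).

(* Extension to ]0, L_2 L v[ of the weak derivative of phi0. *)
Definition ext_dphi0 (L v : R) (dphi0 : R -> R) (x : R) : R :=
  if x < L then dphi0 x
  else (gamma_ v)^-1 * dphi0 (- x / gamma_ v + 2 * L / (1 + v)).

Definition ext_phi1 (L v : R) (phi1 : R -> R) (x : R) : R :=
  if x < L then phi1 x
  else - (gamma_ v)^-1 * phi1 (- x / gamma_ v + 2 * L / (1 + v)).

Definition coef (L v : R) (dphi0 phi1 : R -> R) (n : int) : R[i] :=
  (4 * omega n)^-1 *
  Cintegral `]0, L_2 L v[ (fun x =>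
    (ext_dphi0 L v dphi0 x + ext_phi1 L v phi1 x)%:C *
    cexp (- ((1 - v) / L)%:C * omega n * x%:C)).

End Coefficients.

(* Main.v *)
Require Import Defs.
From HB Require Import structures.
From mathcomp Require Import all_boot all_order all_algebra.
From mathcomp Require Import all_classical all_reals all_analysis.
From mathcomp Require Import complex measurable_realfun.
From mathcomp Require Import ring lra zify.
Import Order.TTheory GRing.Theory Num.Theory.
Import numFieldNormedType.Exports.
Local Open Scope classical_set_scope.
Local Open Scope ring_scope.
Set Implicit Arguments.
Unset Strict Implicit.
Unset Printing Implicit Defensive.

(** In the frame y = x - v t of the string, let p = phi_t + phi_x and
q = phi_t - phi_x be the two travelling components.  The energy is a quarter of
the integral of (1 + v) p^2 + (1 - v) q^2 over ]0, L[.  Laying q, reflected and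
stretched by gamma_v, next to p gives a single function g on ]0, L_2[; this is
the extension that defines the coefficients, and the energy becomes
(1 + v) / 4 times the squared norm of g (energy_unfold).  In real form the
exponentials in the definition of a_n are cos (kappa x) and sin (kappa x) with
kappa = (2 n + 1) pi / L_2.  They are orthogonal and complete on ]0, L_2[, so
Parseval's identity (trig_parseval) writes the energy at every time as a sum
of squares of Fourier coefficients of g.

It remains to see that each pair (X, Y) of coefficients keeps its length.  On
the solution formula this is clear, but the formula need not be established:
pairing the solution with a single mode gives X' = lam Y and Y' = - lam X with
lam = kappa (1 + v), whence X^2 + Y^2 is constant (mode_conserved).  At time 0,
sqrt (X^2 + Y^2) is 2 pi times the modulus of (2 n + 1) a_n.

Only finite energy is available, so these two equations are obtained weakly.
X has the form int phi_t k + int phi_x r.  Testing the variational wave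
equation with theta(t) k(x - v t), where k vanishes at the Dirichlet end, gives
the time derivative of the first term (time_derivative_pairing_t).  In the
second one phi_x has no time derivative; an integration by parts in space, in
which r(0) = 0 and the Dirichlet condition kill the boundary terms, replaces it
by - int phi r', and phi is differentiable in time with values in L2
(is_derive_pairing).  Integrating X' = lam Y and Y' = - lam X against
cos (lam t) and sin (lam t) then shows that (X, Y) rotates
(rotation_conserved).

The two analytic tools are built from approximate identities.  Integration by
parts for a weak derivative (weak_derivative_by_parts) follows by testing with
cutoffs whose derivatives concentrate at the end points.  Completeness follows
by convolving a continuous function with the normalised kernel
cos (pi u / P)^(2 N + 1): an odd power of the cosine is antiperiodic and
expands in the system, and its mass concentrates at u = 0. *)

(** * Square-integrable functions *)

Section SquareIntegrable.
Context {R : realType}.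
Notation mu := (@lebesgue_measure R).
Implicit Types (D : set R) (f g k : R -> R) (c s : R).

Lemma eq_integrable_EFin D f g : measurable D -> (forall x, D x -> f x = g x) ->
  mu.-integrable D (EFin \o f) -> mu.-integrable D (EFin \o g).
Proof.
by move=> mD fg; apply: eq_integrable => // x /set_mem Dx /=; rewrite fg.
Qed.

Lemma integrable_add D f g : measurable D -> mu.-integrable D (EFin \o f) ->
  mu.-integrable D (EFin \o g) -> mu.-integrable D (EFin \o (fun x => f x + g x)).
Proof.
by move=> mD fi gi; apply: (eq_integrable _ _ _ _ (integrableD _ fi gi)).
Qed.

Lemma integrable_scale D c f : measurable D -> mu.-integrable D (EFin \o f) ->
  mu.-integrable D (EFin \o (fun x => c * f x)).
Proof.
by move=> mD fi; apply: (eq_integrable _ _ _ _ (integrableZl _ c fi)).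
Qed.

Lemma integrable_dominated D f g : measurable D -> measurable_fun D f ->
  (forall x, D x -> `|f x| <= g x) ->
  mu.-integrable D (EFin \o g) -> mu.-integrable D (EFin \o f).
Proof.
move=> mD mf fg; apply: le_integrable => //; first exact/measurable_EFinP.
by move=> x Dx /=; rewrite lee_fin (le_trans (fg x Dx))// ler_norm.
Qed.

Lemma L2_on_mul_integrable D f g : measurable D ->
  L2_on D f -> L2_on D g -> mu.-integrable D (EFin \o (fun x => f x * g x)).
Proof.
move=> mD [mf if2] [mg ig2].
apply: (integrable_dominated mD _ _ (integrable_add mD if2 ig2)).
  exact: measurable_funM.
move=> x Dx /=; rewrite normrM.
move: (real_normK (num_real (f x))) (real_normK (num_real (g x))).
move: `|f x| `|g x| => a b <- <-; nra.
Qed.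

Lemma bounded_integrable D f c : measurable D -> (mu D < +oo)%E ->
  measurable_fun D f -> (forall x, D x -> `|f x| <= c) ->
  mu.-integrable D (EFin \o f).
Proof.
move=> mD Dfin mf fc; apply: measurable_bounded_integrable => //.
exists c; split; first exact: num_real.
by move=> M /ltW cM x Dx; exact: le_trans (fc x Dx) cM.
Qed.

Lemma L2_on_cst D c : measurable D -> (mu D < +oo)%E -> L2_on D (cst c).
Proof.
move=> mD Dfin; split; first exact: measurable_cst.
apply: (@bounded_integrable _ _ `|c ^+ 2|) => //.
by apply: measurable_funX; exact: measurable_cst.
Qed.

Lemma L2_on_integrable D f : measurable D -> (mu D < +oo)%E ->
  L2_on D f -> mu.-integrable D (EFin \o f).
Proof.
move=> mD Dfin hf.
apply: (eq_integrable_EFin mD _ (L2_on_mul_integrable mD hf (L2_on_cst 1 mD Dfin))) => //.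
by move=> x _ /=; rewrite mulr1.
Qed.

Lemma L2_on_scale D c f : measurable D -> L2_on D f -> L2_on D (fun x => c * f x).
Proof.
move=> mD [mf if2]; split; first exact: measurable_funM.
apply: (eq_integrable_EFin mD _ (integrable_scale (c ^+ 2) mD if2)) => // x _.
by rewrite exprMn.
Qed.

Lemma L2_on_add D f g : measurable D -> L2_on D f -> L2_on D g ->
  L2_on D (fun x => f x + g x).
Proof.
move=> mD hf hg; split; first by apply: measurable_funD; [case: hf|case: hg].
have [[mf if2] [mg ig2]] := (hf, hg).
have i2fg := integrable_scale 2 mD (L2_on_mul_integrable mD hf hg).
apply: (eq_integrable_EFin mD _ (integrable_add mD (integrable_add mD if2 ig2) i2fg)) => //.
by move=> x _; ring.
Qed.

Lemma L2_on_sub D f g : measurable D -> L2_on D f -> L2_on D g ->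
  L2_on D (fun x => f x - g x).
Proof.
move=> mD hf hg; rewrite (_ : (fun x => _) = (fun x => f x + -1 * g x)).
  by apply: L2_on_add => //; exact: L2_on_scale.
by apply/funext => x; rewrite mulN1r.
Qed.

Lemma eq_L2_on D f g : measurable D -> (forall x, D x -> f x = g x) ->
  L2_on D f -> L2_on D g.
Proof.
move=> mD fg [mf if2]; split.
  by apply: (eq_measurable_fun _ _ mf) => x /set_mem Dx; exact: fg.
by apply: (eq_integrable_EFin mD _ if2) => // x Dx; rewrite fg.
Qed.

Lemma L2_on_subset D D' f : measurable D -> measurable D' -> D' `<=` D ->
  L2_on D f -> L2_on D' f.
Proof.
move=> mD mD' DD' [mf if2]; split; first exact: measurable_funS mf.
exact: integrableS if2.
Qed.

Lemma bounded_L2_on D f c : measurable D -> (mu D < +oo)%E ->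
  measurable_fun D f -> (forall x, D x -> `|f x| <= c) -> L2_on D f.
Proof.
move=> mD Dfin mf fc; split => //.
have [_ ic] := L2_on_cst c mD Dfin.
apply: (integrable_dominated mD _ _ ic) => //; first exact: measurable_funX.
move=> x Dx /=; rewrite normrX ler_pXn2r ?nnegrE//; first exact: fc.
by rewrite (le_trans _ (fc x Dx)).
Qed.

Lemma continuous_itv_integrable (a b : R) f : {within `[a, b], continuous f} ->
  mu.-integrable `]a, b[ (EFin \o f).
Proof.
move=> cf; have : mu.-integrable `[a, b] (EFin \o f).
  by apply: continuous_compact_integrable => //; exact: segment_compact.
by apply: integrableS => //; exact: subset_itv_oo_cc.
Qed.

Lemma continuous_L2_on (a b : R) f : {within `[a, b], continuous f} ->
  L2_on `]a, b[ f.
Proof.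
move=> cf; apply: (@L2_on_subset `[a, b]) => //; first exact: subset_itv_oo_cc.
split; first by apply: subspace_continuous_measurable_fun.
apply: continuous_compact_integrable; first exact: segment_compact.
by move=> x; apply: (continuousM (cf x) (cf x)).
Qed.

(** Cauchy-Schwarz, from the nonnegativity of the integral of (s f + r g)^2 as a
quadratic form in (s, r). *)
Lemma sqr_integral_mul_le D f g : measurable D -> L2_on D f -> L2_on D g ->
  (\int[mu]_(x in D) (f x * g x)) ^+ 2 <=
  (\int[mu]_(x in D) (f x ^+ 2)) * (\int[mu]_(x in D) (g x ^+ 2)).
Proof.
move=> mD hf hg.
set A := \int[mu]_(x in D) (f x ^+ 2); set B := \int[mu]_(x in D) (g x ^+ 2).
set C := \int[mu]_(x in D) (f x * g x).
have ifg := L2_on_mul_integrable mD hf hg.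
have [[mf if2] [mg ig2]] := (hf, hg).
(* the integral of (s f + r g)^2 *)
have quad s r : 0 <= s ^+ 2 * A + (s * r * 2) * C + r ^+ 2 * B.
  have i1 := integrable_scale (s ^+ 2) mD if2.
  have i2 := integrable_scale (s * r * 2) mD ifg.
  have i3 := integrable_scale (r ^+ 2) mD ig2.
  rewrite /A /B /C -!RintegralZl// -RintegralD// -RintegralD//; last exact: integrable_add.
  apply: Rintegral_ge0 => x _.
  by rewrite (_ : _ + _ = (s * f x + r * g x) ^+ 2) ?sqr_ge0//; ring.
have A0 : 0 <= A by apply: Rintegral_ge0 => x _; exact: sqr_ge0.
have B0 : 0 <= B by apply: Rintegral_ge0 => x _; exact: sqr_ge0.
have [A00|An0] := eqVneq A 0.
  have [->|Cn0] := eqVneq C 0; first by rewrite A00 mul0r expr0n.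
  have := quad (- (B + 1) / C) 1.
  rewrite A00 (_ : _ + _ = - (B + 2)); last by field.
  by move=> hq; exfalso; nra.
have Ap : 0 < A by rewrite lt_def An0.
have := quad (- C) A; nra.
Qed.

End SquareIntegrable.

(** * Affine changes of variable for the Lebesgue integral *)

Section AffineSubstitution.
Context {R : realType}.
Notation mu := (@lebesgue_measure R).
Implicit Types (D : set R) (f g k : R -> R) (a b c s : R).

Definition affine c s (x : R) : R := c * x + s.

Lemma measurable_affine c s : measurable_fun [set: measurableTypeR R] (affine c s : _ -> measurableTypeR R).
Proof.
apply: continuous_measurable_fun => x; apply: cvgD; last exact: cvg_cst.
exact: mulrl_continuous.
Qed.

Lemma affine_preimage_measurable c s D : measurable D ->
  measurable (affine c s @^-1` D).
Proof. by move=> mD; rewrite -[_ @^-1` _]setTI; exact: measurable_affine. Qed.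

Lemma affine_preimage_itvoc c s a b : 0 < c ->
  affine c s @^-1` `]a, b] = `](a - s) / c, (b - s) / c]%classic.
Proof.
move=> c0; apply/seteqP; split => x /=; rewrite !in_itv/= ltr_pdivrMr// ler_pdivlMr//;
 rewrite mulrC /affine; by move=> /andP[? ?]; apply/andP; split; lra.
Qed.

Lemma affine_preimage_itvoc_neg c s a b : c < 0 ->
  affine c s @^-1` `]a, b] = `[(b - s) / c, (a - s) / c[%classic.
Proof.
move=> c0; apply/seteqP; split => x /=; rewrite !in_itv/= ltr_ndivlMr// ler_ndivrMr//;
 rewrite mulrC /affine; by move=> /andP[? ?]; apply/andP; split; lra.
Qed.

Lemma affine_preimage_itvoo c s a b : 0 < c ->
  affine c s @^-1` `]a, b[ = `](a - s) / c, (b - s) / c[%classic.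
Proof.
move=> c0; apply/seteqP; split => x /=; rewrite !in_itv/= ltr_pdivrMr// ltr_pdivlMr//;
 rewrite mulrC /affine; by move=> /andP[? ?]; apply/andP; split; lra.
Qed.

Lemma affine_preimage_itvoo_neg c s a b : c < 0 ->
  affine c s @^-1` `]a, b[ = `](b - s) / c, (a - s) / c[%classic.
Proof.
move=> c0; apply/seteqP; split => x /=; rewrite !in_itv/= ltr_ndivlMr// ltr_ndivrMr//;
 rewrite mulrC /affine; by move=> /andP[? ?]; apply/andP; split; lra.
Qed.

(** The right-hand side is a measure in D that agrees with the Lebesgue measure
on half-open intervals, and these determine a measure. *)
Lemma lebesgue_measure_affine c s D : c != 0 -> measurable D ->
  mu D = (`|c|%:E * mu (affine c s @^-1` D))%E.
Proof.
move=> c0 mD.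
pose m1 := (pushforward mu (affine c s : measurableTypeR R -> measurableTypeR R)
  : {measure set (measurableTypeR R) -> \bar R}).
pose r : {nonneg R} := NngNum (normr_ge0 c).
pose m2 : {measure set (measurableTypeR R) -> \bar R} := mscale r (m1 (measurable_affine c s)).
suff : mu D = m2 D by [].
apply: lebesgue_measure_unique => // X [[a b] _ <-] /=.
rewrite /m2 /mscale /m1 /= /pushforward /=.
have [cp|cn|ce] := ltgtP 0 c; last by rewrite -ce eqxx in c0.
- rewrite affine_preimage_itvoc// !lebesgue_measure_itv/= !lte_fin.
  rewrite ltr_pM2r ?invr_gt0// ltrD2r; case: ifPn; rewrite ?mule0// => _.
  by rewrite -!EFinD -EFinM (gtr0_norm cp); congr EFin; field.
- rewrite affine_preimage_itvoc_neg// !lebesgue_measure_itv/= !lte_fin.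
  rewrite ltr_nM2r ?invr_lt0// ltrD2r; case: ifPn; rewrite ?mule0// => _.
  by rewrite -!EFinD -EFinM (ltr0_norm cn); congr EFin; field.
Qed.

(** Stated for measurable integrands, because slices of a finite-energy solution
are no better than square-integrable. *)
Lemma ge0_integral_affine c s D (f : R -> \bar R) : c != 0 -> measurable D ->
  measurable_fun D f -> (forall x, D x -> (0 <= f x)%E) ->
  (\int[mu]_(x in D) f x =
   `|c|%:E * \int[mu]_(x in affine c s @^-1` D) f (affine c s x))%E.
Proof.
move=> c0 mD mf f0.
pose m1 := (pushforward mu (affine c s : measurableTypeR R -> measurableTypeR R)
  : {measure set (measurableTypeR R) -> \bar R}).
pose r : {nonneg R} := NngNum (normr_ge0 c).
transitivity (\int[mscale r (m1 (measurable_affine c s))]_(x in D) f x)%E.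
  by apply: eq_measure_integral => A mA _; exact: lebesgue_measure_affine.
rewrite ge0_integral_mscale//=; congr (_ * _)%E.
rewrite ge0_integral_pushforward//; first exact: measurable_affine.
by move=> x /set_mem; exact: f0.
Qed.

Lemma integrable_affine c s D f : c != 0 -> measurable D ->
  mu.-integrable D (EFin \o f) ->
  mu.-integrable (affine c s @^-1` D) (EFin \o (f \o affine c s)).
Proof.
move=> c0 mD fi; have mD' := affine_preimage_measurable c s mD.
have /measurable_EFinP mf := measurable_int _ fi.
apply/integrableP; split.
  apply/measurable_EFinP; apply: (measurable_comp mD) => //.
    by move=> _ [x Dx <-].
  by apply: measurable_funS (measurable_affine c s).
move/integrableP : fi => [mfE].
rewrite (ge0_integral_affine s c0)//; last exact: measurableT_comp.
move=> h; rewrite ltey; apply/eqP => h2; move: h.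
by rewrite /= h2 mulry gtr0_sg ?normr_gt0// mul1e ltxx.
Qed.

Lemma L2_on_affine c s D f : c != 0 -> measurable D -> L2_on D f ->
  L2_on (affine c s @^-1` D) (f \o affine c s).
Proof.
move=> c0 mD [mf if2]; split.
  apply: (measurable_comp mD) => //; first by move=> _ [x Dx <-].
  by apply: measurable_funS (measurable_affine c s).
exact: (@integrable_affine c s D (fun x => f x ^+ 2)).
Qed.

Lemma Rintegral_affine c s D f : c != 0 -> measurable D ->
  mu.-integrable D (EFin \o f) ->
  \int[mu]_(x in D) f x =
  `|c| * \int[mu]_(x in affine c s @^-1` D) f (affine c s x).
Proof.
move=> c0 mD fi.
have fi' := integrable_affine s c0 mD fi.
have mf := measurable_int _ fi.
have mD' := affine_preimage_measurable c s mD.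
have fin_pos : (\int[mu]_(x in affine c s @^-1` D) (EFin \o (f \o affine c s))^\+ x)%E \is a fin_num.
  by apply: integrable_fin_num => //; exact: integrable_funepos.
have fin_neg : (\int[mu]_(x in affine c s @^-1` D) (EFin \o (f \o affine c s))^\- x)%E \is a fin_num.
  by apply: integrable_fin_num => //; exact: integrable_funeneg.
have Fin_pos : (\int[mu]_(x in D) (EFin \o f)^\+ x)%E \is a fin_num.
  by apply: integrable_fin_num => //; exact: integrable_funepos.
have Fin_neg : (\int[mu]_(x in D) (EFin \o f)^\- x)%E \is a fin_num.
  by apply: integrable_fin_num => //; exact: integrable_funeneg.
have split_int (D' : set R) (h : R -> R) :
    (\int[mu]_(x in D') (EFin \o h)^\+ x)%E \is a fin_num ->
    (\int[mu]_(x in D') (EFin \o h)^\- x)%E \is a fin_num ->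
    \int[mu]_(x in D') h x = fine (\int[mu]_(x in D') (EFin \o h)^\+ x)%E -
      fine (\int[mu]_(x in D') (EFin \o h)^\- x)%E.
  by move=> ? ?; rewrite -fineB// /Rintegral integralE.
have posE : (fun x => (EFin \o f)^\+ (affine c s x))%E =
    ((EFin \o (f \o affine c s))^\+)%E.
  exact: esym (funepos_comp (EFin \o f) (affine c s)).
have negE : (fun x => (EFin \o f)^\- (affine c s x))%E =
    ((EFin \o (f \o affine c s))^\-)%E.
  exact: esym (funeneg_comp (EFin \o f) (affine c s)).
rewrite split_int// (split_int _ (f \o affine c s))// mulrBr.
rewrite (ge0_integral_affine s c0)//; last exact: measurable_funepos.
rewrite (ge0_integral_affine s c0 _ (f := ((EFin \o f)^\-)%E))//; last exact: measurable_funeneg.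
by rewrite posE negE !fineM.
Qed.

End AffineSubstitution.

(** * Continuously differentiable functions *)

Section ContinuouslyDifferentiable.
Context {R : realType}.
Notation mu := (@lebesgue_measure R).
Implicit Types (D : set R) (f g k : R -> R) (a b c s : R).

(** Carrying the derivative as a function makes the calculus rules compose without
computing any derivative operator. *)
Definition C1_deriv (f f' : R -> R) : Prop :=
  (forall x, is_derive x (1 : R) f (f' x)) /\ continuous f'.

Lemma C1_deriv_derivable f f' : C1_deriv f f' -> forall x, derivable f x 1.
Proof. by move=> [df _] x; case: (df x). Qed.

Lemma C1_deriv_derive1 f f' : C1_deriv f f' -> derive1 f = f'.
Proof.
by move=> [df _]; apply/funext => x; rewrite derive1E; exact: (@derive_val _ _ _ _ _ _ _ (df x)).
Qed.

Lemma C1_deriv_continuous f f' : C1_deriv f f' -> continuous f.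
Proof.
move=> hf x; apply: differentiable_continuous; apply/derivable1_diffP.
exact: C1_deriv_derivable hf x.
Qed.

Lemma derive1_C1_deriv f : (forall x, derivable f x 1) -> continuous (derive1 f) ->
  C1_deriv f (derive1 f).
Proof.
by move=> df cf; split => // x; split => //; rewrite derive1E.
Qed.

Lemma is_derive_congr (x : R) f (a b : R) : is_derive x (1 : R) f a -> a = b -> is_derive x (1 : R) f b.
Proof. by move=> h <-. Qed.

Lemma C1_deriv_add f f' g g' : C1_deriv f f' -> C1_deriv g g' ->
  C1_deriv (fun x => f x + g x) (fun x => f' x + g' x).
Proof.
move=> [df cf] [dg cg]; split => x; first exact: is_deriveD (df x) (dg x).
by apply: cvgD; [exact: cf|exact: cg].
Qed.

Lemma C1_deriv_mul f f' g g' : C1_deriv f f' -> C1_deriv g g' ->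
  C1_deriv (fun x => f x * g x) (fun x => f x * g' x + g x * f' x).
Proof.
move=> hf hg; have [[df cf] [dg cg]] := (hf, hg).
have ctf := C1_deriv_continuous hf; have ctg := C1_deriv_continuous hg.
split => x; first exact: is_deriveM (df x) (dg x).
by apply: cvgD; apply: cvgM; [exact: ctf|exact: cg|exact: ctg|exact: cf].
Qed.

Lemma C1_deriv_cst c : C1_deriv (fun=> c) (fun=> 0).
Proof. by split => x; [exact: is_derive_cst|exact: cvg_cst]. Qed.

Lemma C1_deriv_scale c f f' : C1_deriv f f' ->
  C1_deriv (fun x => c * f x) (fun x => c * f' x).
Proof.
move=> hf; have := C1_deriv_mul (C1_deriv_cst c) hf.
by congr C1_deriv; apply/funext => x; rewrite mulr0 addr0.
Qed.

Lemma C1_deriv_sub f f' g g' : C1_deriv f f' -> C1_deriv g g' ->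
  C1_deriv (fun x => f x - g x) (fun x => f' x - g' x).
Proof.
move=> hf hg; have := C1_deriv_add hf (C1_deriv_scale (-1) hg).
by congr C1_deriv; apply/funext => x; rewrite mulN1r.
Qed.

Lemma continuous_affine c s : continuous (affine c s).
Proof.
by move=> x; apply: cvgD; [exact: mulrl_continuous|exact: cvg_cst].
Qed.

Lemma C1_deriv_affine c s f f' : C1_deriv f f' ->
  C1_deriv (f \o affine c s) (fun x => c * f' (affine c s x)).
Proof.
move=> [df cf]; split => x.
  have da : is_derive x (1 : R) (affine c s) c.
    have := is_deriveD (is_deriveM (is_derive_cst c x (1:R)) (is_derive_id x (1 : R))) (is_derive_cst s x (1:R)).
    by move/is_derive_congr; apply; rewrite scaler0 !addr0 scaler1.
  by have := is_derive1_comp (df _) da; move/is_derive_congr; apply; rewrite mulrC.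
apply: cvgM; first exact: cvg_cst.
by apply: continuous_comp; [exact: continuous_affine|exact: cf].
Qed.

Lemma C1_deriv_sin : C1_deriv (@sin R) cos.
Proof. by split; [exact: is_derive_sin|exact: continuous_cos]. Qed.

Lemma C1_deriv_cos : C1_deriv (@cos R) (fun x => - sin x).
Proof.
split; first exact: is_derive_cos.
by move=> x; apply: cvgN; exact: continuous_sin.
Qed.

Lemma Rintegral_itv_cc_oo a b f : mu.-integrable `]a, b[ (EFin \o f) ->
  \int[mu]_(x in `[a, b]) f x = \int[mu]_(x in `]a, b[) f x.
Proof.
move=> fi; have mf := measurable_int _ fi.
by rewrite /Rintegral integral_itv_bndoo.
Qed.

Lemma integral_C1_deriv a b f f' : C1_deriv f f' -> a <= b ->
  \int[mu]_(x in `]a, b[) f' x = f b - f a.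
Proof.
move=> hf; rewrite le_eqVlt => /predU1P[->|ab].
  by rewrite subrr set_itv_ge ?bnd_simp ?ltxx// Rintegral_set0.
have cf' : {within `[a, b], continuous f'} by apply: continuous_subspaceT; case: hf.
rewrite -Rintegral_itv_cc_oo; last exact: continuous_itv_integrable.
rewrite /Rintegral (@continuous_FTC2 _ f' f)//.
- split => [x _||]; first exact: C1_deriv_derivable hf x.
  + by apply: cvg_at_right_filter; exact: C1_deriv_continuous hf a.
  + by apply: cvg_at_left_filter; exact: C1_deriv_continuous hf b.
- by move=> x _; rewrite (C1_deriv_derive1 hf).
Qed.

(** A quadratic remainder bound determines the derivative; it spares a separate
treatment of the corner of Num.max 0. *)
Lemma is_derive_quadratic f x l :
  (forall h, `|f (x + h) - f x - h * l| <= h ^+ 2) -> is_derive x (1 : R) f l.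
Proof.
move=> hq.
have cv : h^-1 *: ((f \o shift x) (h *: (1 : R)) - f x) @[h --> 0^'] --> l.
  apply/cvgrPdist_le => e e0; near=> h.
  have h0 : h != 0 by near: h; exact: nbhs_dnbhs_neq.
  rewrite /= scaler1 distrC.
  rewrite (_ : _ - l = h^-1 * (f (h + x) - f x - h * l)).
    rewrite normrM normfV ler_pdivrMl ?normr_gt0// [h + x]addrC.
    rewrite (le_trans (hq h))// -real_normK ?num_real// expr2 ler_wpM2l//.
    near: h; apply: nbhs_dnbhs; exists e => // y /=.
    by rewrite sub0r normrN => /ltW.
  by rewrite [_ *: _]/(_ * _) mulrBr mulKf// -[LHS]/(_ - l).
split; first by apply/cvg_ex; exists l.
exact: cvg_lim cv.
Unshelve. all: by end_near. Qed.

Lemma C1_deriv_sqr_posp :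
  C1_deriv (fun x : R => Num.max 0 x ^+ 2) (fun x => 2 * Num.max 0 x).
Proof.
split => x.
  apply: is_derive_quadratic => h.
  rewrite ler_norml; case: (leP 0 x) => hx; case: (leP 0 (x + h)) => hxh;
    apply/andP; split; nra.
apply: cvgM; first exact: cvg_cst.
apply: continuous_max; [exact: cvg_cst|exact: cvg_id].
Qed.

End ContinuouslyDifferentiable.

(** * Approximate identities *)

Section Kernels.
Context {R : realType}.
Notation mu := (@lebesgue_measure R).
Implicit Types (D : set R) (f g k : R -> R) (a b c s : R).

Lemma integrable_sub D f g : measurable D -> mu.-integrable D (EFin \o f) ->
  mu.-integrable D (EFin \o g) -> mu.-integrable D (EFin \o (fun x => f x - g x)).
Proof.
move=> mD fi gi; apply: (eq_integrable_EFin mD _ (integrable_add mD fi (integrable_scale (-1) mD gi))).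
by move=> x _; rewrite mulN1r.
Qed.

Lemma integrable_norm D f : measurable D -> mu.-integrable D (EFin \o f) ->
  mu.-integrable D (EFin \o (fun x => `|f x|)).
Proof. by move=> mD fi; apply: (eq_integrable _ _ _ _ (integrable_abse fi)). Qed.

Lemma eq_Rintegral_in D f g : (forall x, D x -> f x = g x) ->
  \int[mu]_(x in D) f x = \int[mu]_(x in D) g x.
Proof. by move=> fg; apply: eq_Rintegral => x /set_mem; exact: fg. Qed.

Lemma Rintegral_dominated_cvg D (f_ : nat -> R -> R) f g : measurable D ->
  (forall n, measurable_fun D (f_ n)) ->
  (forall x, D x -> f_ n x @[n --> \oo] --> f x) ->
  (forall n x, D x -> `|f_ n x| <= g x) ->
  mu.-integrable D (EFin \o g) ->
  mu.-integrable D (EFin \o f) ->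
  \int[mu]_(x in D) f_ n x @[n --> \oo] --> \int[mu]_(x in D) f x.
Proof.
move=> mD mf cf fg gi fi; apply: fine_cvg; rewrite fineK; last exact: integrable_fin_num.
apply: (@dominated_cvg _ _ _ mu D mD (fun n => EFin \o f_ n) (EFin \o f) (EFin \o g)) => //.
- by move=> n; apply/measurable_EFinP; exact: mf.
- by move=> x Dx; apply/fine_cvgP; split; [exact: nearW|exact: cf].
Qed.

(** The concentration hypothesis allows two regimes at once: near the point of
concentration f is close to l, and elsewhere the kernel itself is small, which
is what the summand 1 stands for.  Signed kernels are allowed. *)
Lemma kernel_cvg D (K : nat -> R -> R) f (l B : R) :
  measurable D -> (mu D < +oo)%E ->
  (forall n, mu.-integrable D (EFin \o K n)) ->
  (forall n, mu.-integrable D (EFin \o (fun x => f x * K n x))) ->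
  (forall n, \int[mu]_(x in D) `|K n x| <= B) ->
  \int[mu]_(x in D) K n x @[n --> \oo] --> (1 : R) ->
  (forall e, 0 < e -> \forall n \near \oo, forall x, D x ->
     `|(f x - l) * K n x| <= e * (`|K n x| + 1)) ->
  \int[mu]_(x in D) (f x * K n x) @[n --> \oo] --> l.
Proof.
move=> mD Dfin Ki fKi KB K1 Kf.
have mD0 : 0 <= fine (mu D) by rewrite fine_ge0.
have B0 : 0 <= B by apply: (le_trans _ (KB O)); exact: Rintegral_ge0.
have lK : l * \int[mu]_(x in D) K n x @[n --> \oo] --> l.
  by rewrite -[X in _ --> X](mulr1 l); exact: (cvgM (cvg_cst _) K1).
suff h0 : \int[mu]_(x in D) (f x * K n x) - l * \int[mu]_(x in D) K n x @[n --> \oo] --> (0 : R).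
  have hE : (fun n => \int[mu]_(x in D) (f x * K n x)) =
      (fun n => (\int[mu]_(x in D) (f x * K n x) - l * \int[mu]_(x in D) K n x) +
        l * \int[mu]_(x in D) K n x).
    by apply/funext => n; rewrite subrK.
  by rewrite hE -[X in _ --> X](add0r l); exact: (cvgD h0 lK).
apply/cvgr0Pnorm_le => e e0.
pose C := B + fine (mu D) + 1.
have C0 : 0 < C by rewrite /C; lra.
have eC : 0 < e / C by rewrite divr_gt0.
near=> n.
rewrite -RintegralZl// -RintegralB//; last exact: integrable_scale.
have di : mu.-integrable D (EFin \o (fun x => f x * K n x - l * K n x)).
  by apply: integrable_sub => //; exact: integrable_scale.
apply: le_trans (le_normr_Rintegral _ di) _ => //.
have nKi := integrable_norm mD (Ki n).
have Di1 : mu.-integrable D (EFin \o (fun=> 1)).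
  by apply: (@bounded_integrable _ _ _ 1) => // x _; rewrite normr1.
have sKi : mu.-integrable D (EFin \o (fun x => `|K n x| + 1)).
  exact: integrable_add.
apply: (@le_trans _ _ (\int[mu]_(x in D) (e / C * (`|K n x| + 1)))).
  apply: le_Rintegral => //; first exact: integrable_norm.
    exact: integrable_scale.
  by move=> x Dx; rewrite -mulrBl; move: x Dx; near: n; exact: Kf.
rewrite RintegralZl// RintegralD// Rintegral_cst// mul1r mulrAC ler_pdivrMr//.
by rewrite ler_pM2l// /C; have := KB n; lra.
Unshelve. all: by end_near. Qed.

Definition tent (x : R) : R :=
  4 * (Num.max 0 x - 2 * Num.max 0 (x - 2^-1) + Num.max 0 (x - 1)).

(** A C1 transition from 0 to 1 across [0, 1], as a second difference of the
truncated square; its derivative tent has integral 1. *)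
Definition smoothstep (x : R) : R :=
  2 * (Num.max 0 x ^+ 2 - 2 * Num.max 0 (x - 2^-1) ^+ 2 + Num.max 0 (x - 1) ^+ 2).

Lemma C1_deriv_smoothstep : C1_deriv smoothstep tent.
Proof.
have shiftE s (f f' : R -> R) : C1_deriv f f' ->
    C1_deriv (fun x => f (x - s)) (fun x => f' (x - s)).
  move=> /(C1_deriv_affine 1 (- s)).
  by congr C1_deriv; apply/funext => x; rewrite /= ?mul1r /affine mul1r.
have h0 := @C1_deriv_sqr_posp R.
have := C1_deriv_scale 2 (C1_deriv_add (C1_deriv_sub h0 (C1_deriv_scale 2 (shiftE 2^-1 _ _ h0)))
  (shiftE 1 _ _ h0)).
by congr C1_deriv; apply/funext => x; rewrite /tent; ring.
Qed.

Local Ltac max_cases := rewrite /smoothstep /tent /=;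
  repeat match goal with |- context[Num.max ?a ?b] => case: (leP a b) => ? end.

Lemma smoothstep_le0 x : x <= 0 -> smoothstep x = 0.
Proof. by move=> x0; max_cases; nra. Qed.

Lemma smoothstep_ge1 x : 1 <= x -> smoothstep x = 1.
Proof. by move=> x1; max_cases; nra. Qed.

Lemma smoothstep_ge0 x : 0 <= smoothstep x.
Proof. max_cases; nra. Qed.

Lemma smoothstep_le1 x : smoothstep x <= 1.
Proof. max_cases; nra. Qed.

Lemma tent_ge0 x : 0 <= tent x.
Proof. max_cases; nra. Qed.

Lemma tent_out x : ~ (0 < x < 1) -> tent x = 0.
Proof.
move=> x01; have [x0|x0] := leP x 0; first by max_cases; lra.
have [x1|x1] := leP 1 x; first by max_cases; lra.
by case: x01; rewrite x0 x1.
Qed.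

End Kernels.

(** * Integration by parts for weak derivatives *)

Section WeakDerivative.
Context {R : realType}.
Notation mu := (@lebesgue_measure R).
Implicit Types (D : set R) (f g k w : R -> R) (a b c s : R).

Lemma lebesgue_itvoo_lty a b : (mu `]a, b[ < +oo)%E.
Proof. by rewrite lebesgue_measure_itv/=; case: ifP => _; rewrite ?ltry// -EFinD ltry. Qed.

Lemma within_continuous_near a b w x e : {within `[a, b], continuous w} ->
  x \in `[a, b] -> 0 < e ->
  exists2 d, 0 < d & forall y, a < y < b -> `|y - x| < d -> `|w y - w x| <= e.
Proof.
move=> /subspace_continuousP/(_ x) cw xab e0.
have /cvgrPdist_le/(_ e e0) := cw xab; rewrite near_withinE => -[d /= d0 hd].
exists d => // y /andP[ay yb] yx; rewrite distrC; apply: hd.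
  by rewrite /= distrC.
by rewrite /= in_itv/= !ltW.
Qed.

Lemma integrable_mul_continuous a b w psi : L2_on `]a, b[ w -> continuous psi ->
  mu.-integrable `]a, b[ (EFin \o (fun x => w x * psi x)).
Proof.
move=> hw cpsi; apply: L2_on_mul_integrable => //; apply: continuous_L2_on.
exact: continuous_subspaceT.
Qed.

(** The cutoffs chi rise from 0 to 1 next to a and fall back next to b.  Testing
the weak derivative with psi * chi leaves, besides the two expected integrals,
w * psi integrated against chi'.  Near each end point chi' is, up to sign, an
approximate identity, and it picks out the boundary values of w * psi by
continuity. *)
Lemma weak_derivative_by_parts a b w w' psi psi' : a < b ->
  {within `[a, b], continuous w} -> L2_on `]a, b[ w' ->
  weak_derivative a b w w' -> C1_deriv psi psi' ->
  \int[mu]_(x in `]a, b[) (w x * psi' x) + \int[mu]_(x in `]a, b[) (w' x * psi x) =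
  w b * psi b - w a * psi a.
Proof.
move=> ab cw hw' wd hpsi.
have [_ cpsi'] := hpsi; have cpsi := C1_deriv_continuous hpsi.
have hw := continuous_L2_on cw.
(* M is the inverse width of the transition layers; the factor 4 keeps the two layers apart *)
pose M (n : nat) : R := 4 * n.+1%:R / (b - a).
have ba0 : 0 < b - a by rewrite subr_gt0.
have Mba n : M n * (b - a) = 4 * n.+1%:R by rewrite /M divfK// gt_eqF.
have M0 n : 0 < M n by rewrite divr_gt0// mulr_gt0.
have n1 n : 1 <= n.+1%:R :> R by rewrite ler1n.
have Mlarge d : 0 < d -> \forall n \near \oo, 2 <= M n * d.
  move=> d0; near=> n.
  rewrite /M mulrAC ler_pdivlMr//.
  have : 2 * (b - a) / (4 * d) <= n.+1%:R.
    near: n; exists (Num.truncn (2 * (b - a) / (4 * d))) => // n /= hn.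
    apply: ltW; apply: lt_le_trans (truncnS_gt _) _.
    by rewrite ler_nat.
  by rewrite ler_pdivrMr ?mulr_gt0//; lra.
pose s1 n := - (M n * a) - 1; pose s2 n := - (M n * b) + 2.
pose S1 n := smoothstep \o affine (M n) (s1 n).
pose S2 n := smoothstep \o affine (M n) (s2 n).
pose K1 n x := M n * tent (affine (M n) (s1 n) x).
pose K2 n x := M n * tent (affine (M n) (s2 n) x).
have C1S1 n : C1_deriv (S1 n) (K1 n) by apply: C1_deriv_affine; exact: C1_deriv_smoothstep.
have C1S2 n : C1_deriv (S2 n) (K2 n) by apply: C1_deriv_affine; exact: C1_deriv_smoothstep.
pose chi n x := S1 n x - S2 n x.
have C1chi n : C1_deriv (chi n) (fun x => K1 n x - K2 n x) by exact: C1_deriv_sub.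
have chi_le n x : `|chi n x| <= 1.
  have := smoothstep_ge0 (affine (M n) (s1 n) x); have := smoothstep_ge0 (affine (M n) (s2 n) x).
  have := smoothstep_le1 (affine (M n) (s1 n) x); have := smoothstep_le1 (affine (M n) (s2 n) x).
  by rewrite ler_norml /chi /S1 /S2 /= => *; apply/andP; split; lra.
have chi_cvg x : a < x < b -> chi n x @[n --> \oo] --> (1 : R).
  move=> /andP[ax xb]; apply: cvg_near_cst; near=> n.
  rewrite /chi /S1 /S2 /= smoothstep_ge1 ?smoothstep_le0 ?subr0// /affine /s1 /s2.
    have : 2 <= M n * (b - x) by near: n; apply: Mlarge; rewrite subr_gt0.
    by rewrite mulrBr; lra.
  have : 2 <= M n * (x - a) by near: n; apply: Mlarge; rewrite subr_gt0.
  by rewrite mulrBr; lra.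
have test n : C1c a b (fun x => psi x * chi n x).
  have hpc := C1_deriv_mul hpsi (C1chi n).
  split; first exact: C1_deriv_derivable hpc.
    by rewrite (C1_deriv_derive1 hpc); case: hpc.
  exists (a + (M n)^-1), (b - (M n)^-1).
  have Mi0 : 0 < (M n)^-1 by rewrite invr_gt0.
  have MMi : M n * (M n)^-1 = 1 by rewrite divff// gt_eqF.
  have Mn0 := M0 n; have Mban := Mba n; have n1n := n1 n.
  split; [by lra| |by lra|].
    by rewrite -(ler_pM2l Mn0) mulrDr mulrBr MMi; move: Mban; rewrite mulrBr; lra.
  move=> x xout; rewrite /chi /S1 /S2 /=.
  have [xc|cx] := ltP x (a + (M n)^-1).
    have : M n * x < M n * a + 1 by rewrite -MMi -mulrDr ltr_pM2l.
    move=> h; rewrite !smoothstep_le0 ?subrr ?mulr0// /affine /s1 /s2;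
      by move: Mban; rewrite mulrBr; lra.
  have [dx|xd] := ltP (b - (M n)^-1) x; last by case: xout; rewrite cx xd.
  have : M n * b - 1 < M n * x by rewrite -MMi -mulrBr ltr_pM2l.
  move=> h; rewrite !smoothstep_ge1 ?subrr ?mulr0// /affine /s1 /s2;
    by move: Mban; rewrite mulrBr; lra.
have iwp' := integrable_mul_continuous hw cpsi'.
have iw'p := integrable_mul_continuous hw' cpsi.
have iwp := integrable_mul_continuous hw cpsi.
have cchi n : continuous (chi n) by exact: C1_deriv_continuous (C1chi n).
have cK1 n : continuous (K1 n) by case: (C1S1 n).
have cK2 n : continuous (K2 n) by case: (C1S2 n).
have meas_cont D f : measurable D -> continuous f -> measurable_fun D f.
  by move=> mD cf; apply: measurable_funS (continuous_measurable_fun cf).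
have mw : measurable_fun `]a, b[ w by case: hw.
have mw' : measurable_fun `]a, b[ w' by case: hw'.
have lim_chi f : mu.-integrable `]a, b[ (EFin \o f) ->
    \int[mu]_(x in `]a, b[) (f x * chi n x) @[n --> \oo] --> \int[mu]_(x in `]a, b[) f x.
  move=> fi; have /measurable_EFinP mf := measurable_int _ fi.
  apply: (@Rintegral_dominated_cvg _ _ _ _ (fun x => `|f x|)) => //.
  - by move=> n; apply: measurable_funM => //; exact: meas_cont.
  - move=> x; rewrite /= in_itv/= => xab; rewrite -[X in _ --> X]mulr1.
    by apply: (cvgM (cvg_cst _)); exact: chi_cvg.
  - by move=> n x _; rewrite normrM ler_piMr.
  - exact: integrable_norm.
have lim_K (K : nat -> R -> R) x0 : x0 \in `[a, b] -> (forall n, continuous (K n)) ->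
    (forall n x, 0 <= K n x) -> (forall n, \int[mu]_(x in `]a, b[) K n x = 1) ->
    (forall d, 0 < d -> \forall n \near \oo, forall x, a < x < b -> d <= `|x - x0| -> K n x = 0) ->
    \int[mu]_(x in `]a, b[) (w x * psi x * K n x) @[n --> \oo] --> w x0 * psi x0.
  move=> x0ab cK K0 K1' Kd.
  have iK n : mu.-integrable `]a, b[ (EFin \o K n).
    by apply: continuous_itv_integrable; exact: continuous_subspaceT.
  apply: (@kernel_cvg _ _ _ _ _ 1) => //.
  - exact: lebesgue_itvoo_lty.
  - move=> n; apply: L2_on_mul_integrable => //; apply: continuous_L2_on.
      move=> x; apply: continuousM; first exact: cw.
      by apply: continuous_subspaceT.
    by apply: continuous_subspaceT.
  - move=> n; rewrite (eq_Rintegral_in (g := K n)) ?K1'// => x _.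
    by rewrite ger0_norm.
  - by under eq_fun do rewrite K1'; exact: cvg_cst.
  - move=> e e0.
    have [d d0 hd] : exists2 d, 0 < d & forall y, a < y < b -> `|y - x0| < d ->
        `|w y * psi y - w x0 * psi x0| <= e.
      apply: (@within_continuous_near a b (fun y => w y * psi y)) => //.
      move=> x; apply: continuousM; first exact: cw.
      by apply: continuous_subspaceT.
    near=> n => x; rewrite /= in_itv/= => xab; rewrite normrM.
    have [xd|dx] := ltP `|x - x0| d.
      by rewrite ler_pM ?hd// lerDl.
    have -> : K n x = 0 by move: x xab dx; near: n; exact: Kd.
    by rewrite normr0 mulr0 mulr_ge0// ltW// ltr_pwDr.
have K1_0 n x : 0 <= K1 n x by rewrite mulr_ge0 ?tent_ge0// ltW.
have K2_0 n x : 0 <= K2 n x by rewrite mulr_ge0 ?tent_ge0// ltW.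
have lim1 : \int[mu]_(x in `]a, b[) (w x * psi x * K1 n x) @[n --> \oo] --> w a * psi a.
  apply: lim_K => //.
  - by rewrite in_itv/= lexx ltW.
  - move=> n; rewrite (integral_C1_deriv (C1S1 n)) ?ltW// /S1 /= /affine /s1.
    rewrite smoothstep_ge1 ?smoothstep_le0 ?subr0//; have := Mba n; have := n1 n; rewrite ?mulrBr; lra.
  - move=> d d0; near=> n => x /andP[ax xb] dx.
    rewrite /K1 tent_out ?mulr0// /affine /s1 => /andP[_ h].
    have : 2 <= M n * d by near: n; exact: Mlarge.
    have : M n * d <= M n * (x - a) by rewrite ler_pM2l//; rewrite gtr0_norm ?subr_gt0 in dx.
    by rewrite mulrBr; lra.
have lim2 : \int[mu]_(x in `]a, b[) (w x * psi x * K2 n x) @[n --> \oo] --> w b * psi b.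
  apply: lim_K => //.
  - by rewrite in_itv/= lexx ltW.
  - move=> n; rewrite (integral_C1_deriv (C1S2 n)) ?ltW// /S2 /= /affine /s2.
    rewrite smoothstep_ge1 ?smoothstep_le0 ?subr0//; have := Mba n; have := n1 n; rewrite ?mulrBr; lra.
  - move=> d d0; near=> n => x /andP[ax xb] dx.
    rewrite /K2 tent_out ?mulr0// /affine /s2 => /andP[h _].
    have : 2 <= M n * d by near: n; exact: Mlarge.
    have : M n * d <= M n * (b - x).
      by rewrite ler_pM2l//; rewrite distrC gtr0_norm ?subr_gt0 in dx.
    by rewrite mulrBr; lra.
(* the weak derivative tested with psi * chi, for each n *)
have eqn n : \int[mu]_(x in `]a, b[) (w x * psi' x * chi n x) +
    (\int[mu]_(x in `]a, b[) (w x * psi x * K1 n x) -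
     \int[mu]_(x in `]a, b[) (w x * psi x * K2 n x)) +
    \int[mu]_(x in `]a, b[) (w' x * psi x * chi n x) = 0.
  have i1 : mu.-integrable `]a, b[ (EFin \o (fun x => w x * psi' x * chi n x)).
    apply: (eq_integrable_EFin _ _ (integrable_mul_continuous (psi := fun x => psi' x * chi n x) hw _)) => //.
      by move=> x _; rewrite mulrA.
    by move=> x; apply: cvgM; [exact: cpsi'|exact: cchi].
  have iK (K : nat -> R -> R) : continuous (K n) ->
      mu.-integrable `]a, b[ (EFin \o (fun x => w x * psi x * K n x)).
    move=> cK; apply: (eq_integrable_EFin _ _ (integrable_mul_continuous (psi := fun x => psi x * K n x) hw _)) => //.
      by move=> x _; rewrite mulrA.
    by move=> x; apply: cvgM; [exact: cpsi|exact: cK].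
  have hpc := C1_deriv_mul hpsi (C1chi n).
  have := wd _ (test n); rewrite (C1_deriv_derive1 hpc).
  have -> : \int[mu]_(x in `]a, b[) (w' x * (psi x * chi n x)) =
      \int[mu]_(x in `]a, b[) (w' x * psi x * chi n x).
    by apply: eq_Rintegral_in => x _; rewrite mulrA.
  move=> /eqP; rewrite -addr_eq0 => /eqP <-; congr (_ + _).
  rewrite -RintegralB//; [|exact: iK|exact: iK].
  rewrite -RintegralD//; last by apply: integrable_sub => //; exact: iK.
  by apply: eq_Rintegral_in => x _; ring.
have lim : \int[mu]_(x in `]a, b[) (w x * psi' x * chi n x) +
    (\int[mu]_(x in `]a, b[) (w x * psi x * K1 n x) -
     \int[mu]_(x in `]a, b[) (w x * psi x * K2 n x)) +
    \int[mu]_(x in `]a, b[) (w' x * psi x * chi n x) @[n --> \oo] -->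
    \int[mu]_(x in `]a, b[) (w x * psi' x) + (w a * psi a - w b * psi b) +
    \int[mu]_(x in `]a, b[) (w' x * psi x).
  exact: (cvgD (cvgD (lim_chi _ iwp') (cvgB lim1 lim2)) (lim_chi _ iw'p)).
move: lim; rewrite (funext eqn) => lim.
have h : \int[mu]_(x in `]a, b[) (w x * psi' x) + (w a * psi a - w b * psi b) +
    \int[mu]_(x in `]a, b[) (w' x * psi x) = 0.
  rewrite -(cvg_lim (@Rhausdorff R) lim); apply: cvg_lim => //.
  exact: cvg_cst.
by apply/eqP; rewrite -subr_eq0 -h; apply/eqP; ring.
Unshelve. all: by end_near. Qed.

End WeakDerivative.

(** * Orthogonal systems in L2 *)

Section OrthogonalSystem.
Context {R : realType}.
Notation mu := (@lebesgue_measure R).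
Implicit Types (D : set R) (f g h : R -> R) (u : nat -> R -> R) (al : nat -> R).

Definition lincomb u al (N : nat) (x : R) : R := \sum_(k < N) al k * u k x.

Lemma lincomb_recr u al N : lincomb u al N.+1 = (fun x => lincomb u al N x + al N * u N x).
Proof. by apply/funext => x; rewrite /lincomb big_ord_recr. Qed.

Lemma lincomb0 u al : lincomb u al 0 = (fun=> 0).
Proof. by apply/funext => x; rewrite /lincomb big_ord0. Qed.

Lemma L2_on_lincomb D u al N : measurable D -> (forall k, L2_on D (u k)) ->
  L2_on D (lincomb u al N).
Proof.
move=> mD hu; elim: N => [|N IH].
  rewrite lincomb0; apply: (eq_L2_on mD _ (L2_on_scale 0 mD (hu 0))).
  by move=> x _; rewrite mul0r.
by rewrite lincomb_recr; apply: L2_on_add => //; exact: L2_on_scale.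
Qed.

Lemma integral_mul_lincomb D u al N h : measurable D -> (forall k, L2_on D (u k)) ->
  L2_on D h ->
  \int[mu]_(x in D) (h x * lincomb u al N x) =
  \sum_(k < N) al k * \int[mu]_(x in D) (h x * u k x).
Proof.
move=> mD hu hh; elim: N => [|N IH].
  rewrite big_ord0 lincomb0 (eq_Rintegral_in (g := fun=> 0)); last by move=> x; rewrite mulr0.
  by rewrite Rintegral_cst// mul0r.
rewrite big_ord_recr -IH lincomb_recr /=.
rewrite (eq_Rintegral_in (g := fun x => h x * lincomb u al N x + al N * (h x * u N x))).
  rewrite RintegralD//; last 2 first.
  - by apply: L2_on_mul_integrable => //; exact: L2_on_lincomb.
  - by apply: integrable_scale => //; exact: L2_on_mul_integrable.
  by rewrite RintegralZl//; exact: L2_on_mul_integrable.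
by move=> x _; ring.
Qed.

(** The usual expansion of the distance from g to a linear combination of
orthogonal vectors, all of squared norm q. *)
Lemma integral_sqr_sub_lincomb D u al N g (q : R) : measurable D -> (forall k, L2_on D (u k)) ->
  (forall j k, \int[mu]_(x in D) (u j x * u k x) = q * (j == k)%:R) ->
  L2_on D g ->
  \int[mu]_(x in D) ((g x - lincomb u al N x) ^+ 2) =
  \int[mu]_(x in D) (g x ^+ 2) -
  2 * (\sum_(k < N) al k * \int[mu]_(x in D) (g x * u k x)) +
  q * \sum_(k < N) al k ^+ 2.
Proof.
move=> mD hu orth hg.
have hl := L2_on_lincomb al N mD hu.
(* the pairing of the combination with each of its vectors extracts the coefficient *)
have lu k : (k < N)%N -> \int[mu]_(x in D) (lincomb u al N x * u k x) = q * al k.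
  move=> kN; rewrite (eq_Rintegral_in (g := fun x => u k x * lincomb u al N x)).
    rewrite integral_mul_lincomb// (bigD1 (Ordinal kN))//= orth eqxx mulr1.
    rewrite big1 ?addr0 ?[al k * _]mulrC// => j /negP jk.
    rewrite orth (_ : (k == j :> nat) = false) ?mulr0 ?mulr0//.
    by apply/negP => /eqP kj; apply: jk; apply/eqP/val_inj.
  by move=> x _; rewrite mulrC.
have -> : q * \sum_(k < N) al k ^+ 2 =
    \int[mu]_(x in D) (lincomb u al N x ^+ 2).
  rewrite integral_mul_lincomb// mulr_sumr; apply: eq_bigr => k _.
  by rewrite lu//; ring.
rewrite -integral_mul_lincomb//.
have igl := L2_on_mul_integrable mD hg hl.
rewrite -RintegralZl// -RintegralB//; last 2 first.
- by case: hg.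
- exact: integrable_scale.
rewrite -RintegralD//; last 2 first.
- by apply: integrable_sub => //; [case: hg|exact: integrable_scale].
- by case: hl.
by apply: eq_Rintegral_in => x _; ring.
Qed.

(** Partial sums are bounded by Bessel's inequality; since orthogonal projection
minimises the distance, they come as close to the squared norm of g as linear
combinations come to g. *)
Lemma parseval_of_dense D u g (q : R) : measurable D -> 0 < q ->
  (forall k, L2_on D (u k)) ->
  (forall j k, \int[mu]_(x in D) (u j x * u k x) = q * (j == k)%:R) ->
  L2_on D g ->
  (forall e, 0 < e -> exists N al,
     \int[mu]_(x in D) ((g x - lincomb u al N x) ^+ 2) <= e) ->
  q^-1 * \sum_(k < N) (\int[mu]_(x in D) (g x * u k x)) ^+ 2 @[N --> \oo] -->
  \int[mu]_(x in D) (g x ^+ 2).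
Proof.
move=> mD q0 hu orth hg dense.
set b := fun k => \int[mu]_(x in D) (g x * u k x).
set G := \int[mu]_(x in D) (g x ^+ 2).
pose S N := q^-1 * \sum_(k < N) b k ^+ 2.
have SG N : S N <= G.
  have : 0 <= \int[mu]_(x in D) ((g x - lincomb u (fun k => q^-1 * b k) N x) ^+ 2).
    by apply: Rintegral_ge0 => x _; exact: sqr_ge0.
  rewrite (integral_sqr_sub_lincomb _ _ mD hu orth hg) -/G.
  have -> : \sum_(k < N) q^-1 * b k * b k = S N.
    by rewrite /S mulr_sumr; apply: eq_bigr => k _; rewrite -mulrA.
  have -> : q * \sum_(k < N) (q^-1 * b k) ^+ 2 = S N.
    rewrite /S !mulr_sumr; apply: eq_bigr => k _; rewrite exprMn expr2 !mulrA divff ?gt_eqF// mul1r//.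
  lra.
apply/cvgrPdist_le => e e0.
have [N [al hN]] := dense _ e0.
exists N => // n /= Nn.
rewrite -/(S n) ger0_norm; last by rewrite subr_ge0.
apply: le_trans hN.
have SNn : S N <= S n.
  rewrite /S ler_pM2l ?invr_gt0// -(subnKC Nn) big_split_ord/= lerDl.
  by apply: sumr_ge0 => i _; exact: sqr_ge0.
rewrite (integral_sqr_sub_lincomb _ _ mD hu orth hg) -/G.
suff : S N >= 2 * (\sum_(k < N) al k * b k) - q * \sum_(k < N) al k ^+ 2.
  by move: SNn; lra.
rewrite /S !mulr_sumr -sumrB; apply: ler_sum => k _.
rewrite -subr_ge0 (_ : _ - _ = q * (al k - q^-1 * b k) ^+ 2).
  by rewrite mulr_ge0 ?sqr_ge0// ltW.
by field; rewrite gt_eqF.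
Qed.

End OrthogonalSystem.

(** * The antiperiodic trigonometric system *)

Section TrigonometricSystem.
Context {R : realType}.
Notation mu := (@lebesgue_measure R).
Variable P : R.
Hypothesis P0 : 0 < P.
Implicit Types (f g h : R -> R) (j k n : nat).

(** The frequencies whose sines and cosines change sign under translation by P. *)
Definition freq (n : nat) : R := n.*2.+1%:R * pi / P.

(** A single phase-shifted cosine covers the cosines (even index) and the sines (odd
index), so that orthogonality needs only one product formula. *)
Definition trig (k : nat) (x : R) : R := cos (freq k./2 * x - (odd k)%:R * (pi / 2)).

Lemma trig_double n x : trig n.*2 x = cos (freq n * x).
Proof. by rewrite /trig odd_double doubleK mul0r subr0. Qed.

Lemma trig_doubleS n x : trig n.*2.+1 x = sin (freq n * x).
Proof. by rewrite /trig /= odd_double uphalf_double mul1r cosBpihalf. Qed.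

Lemma freq_gt0 n : 0 < freq n.
Proof. by rewrite !mulr_gt0 ?invr_gt0 ?pi_gt0// ltr0n. Qed.

Lemma C1_deriv_cos_affine c s : C1_deriv (fun x : R => cos (c * x + s)) (fun x => - (c * sin (c * x + s))).
Proof.
have := C1_deriv_affine c s (@C1_deriv_cos R).
by congr C1_deriv; apply/funext => x; rewrite mulrN.
Qed.

Lemma continuous_trig k : continuous (trig k).
Proof.
exact: C1_deriv_continuous (C1_deriv_cos_affine (freq k./2) (- ((odd k)%:R * (pi / 2)))).
Qed.

Lemma integral_cos_period (c s : R) (m : nat) : c != 0 -> c * P = (pi *+ 2) *+ m ->
  \int[mu]_(x in `]0, P[) cos (c * x + s) = 0.
Proof.
move=> c0 cP.
have h := C1_deriv_scale c^-1 (C1_deriv_affine c s (@C1_deriv_sin R)).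
have := integral_C1_deriv h (ltW P0).
rewrite /affine /= (eq_Rintegral_in (g := fun x => cos (c * x + s))).
  move=> ->; rewrite mulr0 add0r cP (addrC _ s) (periodicn (@sinD2pi R)) subrr//.
by move=> x _; rewrite mulrA mulVf// mul1r.
Qed.

Lemma integral_trig_mul j k :
  \int[mu]_(x in `]0, P[) (trig j x * trig k x) = P / 2 * (j == k)%:R.
Proof.
pose ph (i : nat) : R := (odd i)%:R * (pi / 2).
pose F1 x := cos ((freq j./2 + freq k./2) * x - (ph j + ph k)).
pose F2 x := cos ((freq j./2 - freq k./2) * x - (ph j - ph k)).
have iF c s : mu.-integrable `]0, P[ (EFin \o (fun x => cos (c * x + s))).
  apply: continuous_itv_integrable; apply: continuous_subspaceT.
  exact: C1_deriv_continuous (C1_deriv_cos_affine c s).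
have two (a m : nat) : a = (2 * m)%N -> a%:R * pi = pi *+ 2 *+ m :> R.
  by move=> ->; rewrite mulr_natl mulrnA.
have I1 : \int[mu]_(x in `]0, P[) F1 x = 0.
  apply: (@integral_cos_period _ _ (j./2 + k./2).+1).
    by rewrite gt_eqF// addr_gt0// freq_gt0.
  rewrite /freq -!mulrDl divfK ?gt_eqF// -natrD; apply: two.
  by rewrite -!mul2n; lia.
have I2 : \int[mu]_(x in `]0, P[) F2 x = P * (j == k)%:R.
  have [jk|jk|jk] := ltngtP j./2 k./2.
  - have -> : (j == k) = false by apply/negbTE/eqP => jke; rewrite jke ltnn in jk.
    rewrite mulr0 (eq_Rintegral_in (g := fun x => cos ((freq k./2 - freq j./2) * x + (ph j - ph k)))).
      apply: (@integral_cos_period _ _ (k./2 - j./2)).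
        by rewrite subr_eq0 /freq; apply/negP => /eqP /(divIf (lt0r_neq0 P0)) /(mulIf (lt0r_neq0 (@pi_gt0 R))) /eqP;
         rewrite eqr_nat -!mul2n; lia.
      rewrite /freq -!mulrBl divfK ?gt_eqF// -natrB; last by rewrite -!mul2n; lia.
      by apply: two; rewrite -!mul2n; lia.
    by move=> x _; rewrite /F2 -cosN; congr cos; ring.
  - have -> : (j == k) = false by apply/negbTE/eqP => jke; rewrite jke ltnn in jk.
    rewrite mulr0; apply: (@integral_cos_period _ _ (j./2 - k./2)).
      by rewrite subr_eq0 /freq; apply/negP => /eqP /(divIf (lt0r_neq0 P0)) /(mulIf (lt0r_neq0 (@pi_gt0 R))) /eqP;
         rewrite eqr_nat -!mul2n; lia.
    rewrite /freq -!mulrBl divfK ?gt_eqF// -natrB; last by rewrite -!mul2n; lia.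
    by apply: two; rewrite -!mul2n; lia.
  - rewrite (eq_Rintegral_in (g := fun=> (j == k)%:R)).
      rewrite Rintegral_cst//= lebesgue_measure_itv/= lte_fin P0 -EFinD /= subr0 mulrC//.
    move=> x _; rewrite /F2 jk subrr mul0r sub0r cosN /ph.
    have -> : (j == k) = (odd j == odd k).
      apply/eqP/eqP => [->//|ojk].
      by rewrite -(odd_double_half j) -(odd_double_half k) ojk jk.
    case: (odd j); case: (odd k) => /=; rewrite ?subrr ?cos0 ?mul1r ?mul0r ?subr0 ?cos_pihalf//.
    by rewrite sub0r cosN cos_pihalf.
rewrite (eq_Rintegral_in (g := fun x => 2^-1 * F1 x + 2^-1 * F2 x)).
  rewrite RintegralD//; [|by apply: integrable_scale => //; exact: iF..].
  rewrite !RintegralZl//; [|exact: iF..].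
  by rewrite I1 I2 mulr0 add0r mulrA (mulrC _ P).
move=> x _; rewrite /F1 /F2 /trig -!/(ph _).
rewrite (_ : (_ + _) * x - _ = (freq j./2 * x - ph j) + (freq k./2 * x - ph k)); last by ring.
rewrite (_ : (_ - _) * x - _ = (freq j./2 * x - ph j) - (freq k./2 * x - ph k)); last by ring.
rewrite -/(ph j) -/(ph k).
move: (freq j./2 * x - ph j) (freq k./2 * x - ph k) => a b.
by rewrite cosD cosB; field.
Qed.

End TrigonometricSystem.

(** * Trigonometric polynomials and convolutions *)

Section TrigonometricPolynomials.
Context {R : realType}.
Notation mu := (@lebesgue_measure R).
Variable P : R.
Hypothesis P0 : 0 < P.
Implicit Types (f g h : R -> R) (j k n : nat).
Local Notation D := (`]0, P[)%classic.

Lemma Rintegral_split (a b c : R) f : a <= b -> b <= c ->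
  mu.-integrable `]a, c[ (EFin \o f) ->
  \int[mu]_(x in `]a, c[) f x = \int[mu]_(x in `]a, b[) f x + \int[mu]_(x in `]b, c[) f x.
Proof.
move=> ab; rewrite le_eqVlt => /predU1P[<- fi|bc fi].
  by rewrite (@set_itv_ge _ _ (BRight b) (BLeft b)) ?bnd_simp ?ltxx// Rintegral_set0 addr0.
have -> : \int[mu]_(x in `]a, b[) f x = \int[mu]_(x in `]a, b]) f x.
  apply: Rintegral_itv_bndo_bndc; apply: integrableS fi => //.
  by apply: subset_itvl; rewrite bnd_simp ltW.
by rewrite -(@Rintegral_itvB _ _ _ _ b fi) ?bnd_simp// addrC subrK.
Qed.

Definition trig_poly h := exists N al, forall x, h x = lincomb (trig P) al N x.

Lemma trig_poly_widen al N M x : (N <= M)%N ->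
  lincomb (trig P) al N x =
  lincomb (trig P) (fun k => if (k < N)%N then al k else 0) M x.
Proof.
move=> NM; rewrite /lincomb (big_ord_widen M (fun k => al k * trig P k x))//.
by rewrite big_mkcond; apply: eq_bigr => k _; case: ifP => // _; rewrite mul0r.
Qed.

Lemma trig_poly_add f g : trig_poly f -> trig_poly g -> trig_poly (fun x => f x + g x).
Proof.
move=> [N [al fE]] [M [be gE]]; exists (maxn N M).
exists (fun k => (if (k < N)%N then al k else 0) + (if (k < M)%N then be k else 0)) => x.
rewrite fE gE (trig_poly_widen _ _ (leq_maxl N M)) (trig_poly_widen _ _ (leq_maxr N M)).
by rewrite /lincomb -big_split /=; apply: eq_bigr => k _; rewrite mulrDl.
Qed.

Lemma trig_poly_scale c f : trig_poly f -> trig_poly (fun x => c * f x).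
Proof.
move=> [N [al fE]]; exists N, (fun k => c * al k) => x.
by rewrite fE /lincomb mulr_sumr; apply: eq_bigr => k _; rewrite mulrA.
Qed.

Lemma trig_poly_trig k : trig_poly (trig P k).
Proof.
exists k.+1, (fun j => (j == k)%:R) => x.
rewrite /lincomb big_ord_recr/= eqxx mul1r big1 ?add0r// => i _.
by rewrite (_ : (i == k :> nat) = false) ?mul0r//; apply/negbTE; rewrite neq_ltn ltn_ord.
Qed.

Lemma eq_trig_poly f g : f =1 g -> trig_poly f -> trig_poly g.
Proof. by move=> fg [N [al fE]]; exists N, al => x; rewrite -fg. Qed.

Lemma continuous_lincomb_trig al N : continuous (lincomb (trig P) al N).
Proof.
elim: N => [|N IH]; first by rewrite lincomb0; exact: cst_continuous.
rewrite lincomb_recr => x; apply: cvgD; first exact: IH.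
by apply: cvgM; [exact: cvg_cst|exact: continuous_trig].
Qed.

Definition convolution h (K : R -> R) (x : R) := \int[mu]_(y in D) (h y * K (x - y)).

(** Kernels for which convolution over ]0, P[ produces trigonometric polynomials.
They form a vector space, which avoids writing out the expansion of a power of
the cosine. *)
Definition smoothing (K : R -> R) := continuous K /\
  forall h, L2_on D h -> trig_poly (convolution h K).

Lemma continuous_reflect (K : R -> R) x : continuous K -> continuous (fun y => K (x - y)).
Proof.
move=> cK y; apply: (@continuous_comp _ _ _ (fun y => x - y)); last exact: cK.
by apply: cvgB; [exact: cvg_cst|exact: cvg_id].
Qed.

Lemma smoothing_add (K1 K2 : R -> R) : smoothing K1 -> smoothing K2 ->
  smoothing (fun u => K1 u + K2 u).
Proof.
move=> [cK1 sK1] [cK2 sK2]; split.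
  by move=> u; apply: cvgD; [exact: cK1|exact: cK2].
move=> h hh; apply: eq_trig_poly (trig_poly_add (sK1 h hh) (sK2 h hh)) => x.
rewrite /convolution -RintegralD//; last 2 first.
- by apply: integrable_mul_continuous => //; exact: continuous_reflect.
- by apply: integrable_mul_continuous => //; exact: continuous_reflect.
by apply: eq_Rintegral_in => y _; rewrite mulrDr.
Qed.

Lemma smoothing_scale c (K : R -> R) : smoothing K -> smoothing (fun u => c * K u).
Proof.
move=> [cK sK]; split.
  by move=> u; apply: cvgM; [exact: cvg_cst|exact: cK].
move=> h hh; apply: eq_trig_poly (trig_poly_scale c (sK h hh)) => x.
rewrite /convolution -RintegralZl//; last first.
  by apply: integrable_mul_continuous => //; exact: continuous_reflect.
by apply: eq_Rintegral_in => y _; rewrite mulrCA.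
Qed.

Lemma smoothing_cos n : smoothing (fun u => cos (freq P n * u)).
Proof.
split.
  rewrite (_ : (fun u => _) = trig P n.*2); first exact: continuous_trig.
  by apply/funext => x; rewrite trig_double.
move=> h hh.
have := trig_poly_add
  (trig_poly_scale (\int[mu]_(y in D) (h y * trig P n.*2 y)) (trig_poly_trig n.*2))
  (trig_poly_scale (\int[mu]_(y in D) (h y * trig P n.*2.+1 y)) (trig_poly_trig n.*2.+1)).
apply: eq_trig_poly => x.
have ih k := integrable_mul_continuous hh (@continuous_trig _ P k).
rewrite ![_ * trig P _ x]mulrC -!RintegralZl// -RintegralD//; last 2 first.
- exact: integrable_scale.
- exact: integrable_scale.
apply: eq_Rintegral_in => y _.
by rewrite !trig_double !trig_doubleS mulrBr cosB; ring.
Qed.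

(** By the product formula, a factor cos^2 only shifts the index n by one either way;
at n = 0 the shifted frequency is minus the lowest one, which is harmless
because the cosine is even. *)
Lemma smoothing_cos_pow N n :
  smoothing (fun u => cos (pi / P * u) ^+ N.*2 * cos (freq P n * u)).
Proof.
elim: N n => [|N IH] n.
  have := smoothing_cos n.
  by congr smoothing; apply/funext => x; rewrite expr0 mul1r.
have := smoothing_add (smoothing_scale 2^-1 (IH n))
  (smoothing_add (smoothing_scale 4^-1 (IH n.+1)) (smoothing_scale 4^-1 (IH n.-1))).
congr smoothing; apply/funext => u.
rewrite doubleS 2!exprS; set A := cos _ ^+ N.*2.
suff : cos (freq P n.+1 * u) + cos (freq P n.-1 * u) =
    4 * cos (pi / P * u) ^+ 2 * cos (freq P n * u) - 2 * cos (freq P n * u).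
  by move=> e; rewrite -!mulrDr e; field.
set th := pi / P * u; set ph := freq P n * u.
have -> : freq P n.+1 * u = ph + th *+ 2.
  rewrite /ph /th /freq doubleS -addn2 natrD; ring.
have -> : cos (freq P n.-1 * u) = cos (ph - th *+ 2).
  rewrite /ph /th; case: n {IH ph} => [|n] /=.
    by rewrite -cosN /freq double0; congr cos; ring.
  by congr cos; rewrite /freq doubleS -[_.+3]addn2 natrD; ring.
rewrite cosD cosB cos_mulr2n; ring.
Qed.

Definition peak (N : nat) (u : R) : R := cos (pi / P * u) ^+ N.*2.+1.

Lemma smoothing_peak N : smoothing (peak N).
Proof.
have := smoothing_cos_pow N 0.
by congr smoothing; apply/funext => u; rewrite /peak exprSr /freq /= mul1r.
Qed.

End TrigonometricPolynomials.

(** * Powers of the cosine as an approximate identity *)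

Section PeakKernel.
Context {R : realType}.
Notation mu := (@lebesgue_measure R).
Variable P : R.
Hypothesis P0 : 0 < P.
Implicit Types (f g h : R -> R) (j k n N : nat).
Local Notation D := (`]0, P[)%classic.

(** The integral of a P-periodic function over a period does not depend on the
period chosen. *)
Lemma periodic_integral_reflect f x : continuous f -> (forall u, f (u + P) = f u) ->
  0 <= x -> x <= P ->
  \int[mu]_(y in D) f (x - y) = \int[mu]_(y in D) f y.
Proof.
move=> cf fP x0 xP.
have fi a b : mu.-integrable `]a, b[ (EFin \o f).
  by apply: continuous_itv_integrable; exact: continuous_subspaceT.
have -> : \int[mu]_(y in D) f (x - y) = \int[mu]_(y in `]x - P, x[) f y.
  have N1 : (-1 : R) != 0 by rewrite oppr_eq0 oner_neq0.
  rewrite [RHS](Rintegral_affine x N1)// normrN1 mul1r.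
  rewrite affine_preimage_itvoo_neg ?ltrN10//.
  rewrite subrr mul0r (_ : (x - P - x) / -1 = P); last by field.
  by apply: eq_Rintegral_in => y _; rewrite /affine mulN1r addrC.
rewrite (@Rintegral_split _ (x - P) 0 x)// ?subr_le0//.
rewrite (@Rintegral_split _ 0 x P)// addrC; congr (_ + _).
rewrite [RHS](Rintegral_affine P (oner_neq0 R))// normr1 mul1r.
rewrite affine_preimage_itvoo// subrr mul0r divr1.
by apply: eq_Rintegral_in => y _; rewrite /affine mul1r fP.
Qed.

Lemma continuous_peak N : continuous (peak P N).
Proof. by case: (smoothing_peak P N). Qed.

Lemma normr_peakE N u : `|peak P N u| = `|cos (pi / P * u)| ^+ N.*2.+1.
Proof. by rewrite /peak normrX. Qed.

Let piP : 0 < pi / P. Proof. by rewrite divr_gt0// pi_gt0. Qed.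
Let piPP : pi / P * P = pi. Proof. by rewrite divfK// gt_eqF. Qed.
Let pihalfP : pi / 2 = pi / P * (P / 2). Proof. by rewrite mulrA piPP. Qed.

Let in_0pi (a : R) : 0 <= a -> a <= P -> pi / P * a \in `[0, pi].
Proof.
move=> a0 aP; rewrite in_itv/=; apply/andP; split; first by rewrite mulr_ge0// ltW.
by rewrite -[X in _ <= X]piPP ler_pM2l.
Qed.

Lemma cos_decr (a b : R) : 0 <= a -> a <= b -> b <= P -> cos (pi / P * b) <= cos (pi / P * a).
Proof.
move=> a0 ab bP; rewrite leNgt ltr_cos.
- by rewrite ltr_pM2l// -leNgt.
- by apply: in_0pi => //; lra.
- by apply: in_0pi => //; lra.
Qed.

Lemma cos_half_ge0 u : `|u| <= P / 2 -> 0 <= cos (pi / P * u).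
Proof.
move=> uP; apply: cos_ge0_pihalf; rewrite -ler_norml normrM (gtr0_norm piP).
by rewrite pihalfP ler_pM2l.
Qed.

(** Away from the multiples of P the kernel is small.  The other peak, at |u| = P, is
excluded as well: for x and y in ]0, P[ the difference x - y stays away from it
once x is fixed. *)
Lemma cos_tail (d u : R) : 0 <= d -> d <= `|u| -> `|u| <= P - d ->
  `|cos (pi / P * u)| <= cos (pi / P * d).
Proof.
move=> d0 du uP.
have -> : cos (pi / P * u) = cos (pi / P * `|u|).
  by rewrite -[LHS]cos_norm normrM (gtr0_norm piP).
rewrite ler_norml; apply/andP; split; last by apply: cos_decr => //; lra.
have -> : - cos (pi / P * d) = cos (pi / P * (P - d)).
  have e : cos (pi / P * d) = - cos (pi / P * d - pi) by rewrite -cosDpi subrK.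
  by rewrite e opprK -cosN opprB mulrBr piPP.
by apply: cos_decr => //; lra.
Qed.

Definition peak_mass N : R := \int[mu]_(u in D) `|peak P N u|.

Lemma integrable_continuous f a b : continuous f -> mu.-integrable `]a, b[ (EFin \o f).
Proof. by move=> cf; apply: continuous_itv_integrable; exact: continuous_subspaceT. Qed.

Lemma continuous_norm f : continuous f -> continuous (fun x => `|f x|).
Proof. by move=> cf x; apply: cvg_norm; exact: cf. Qed.

Lemma peak_mass_ge N d : 0 < d -> d <= P / 2 -> d * cos (pi / P * d) ^+ N.*2.+1 <= peak_mass N.
Proof.
move=> d0 dP; rewrite /peak_mass (@Rintegral_split _ 0 d P) ?(ltW d0)//; first last.
- by apply: integrable_continuous; apply: continuous_norm; exact: continuous_peak.
- lra.
rewrite -[leLHS]addr0 lerD//; last by apply: Rintegral_ge0.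
have dE : \int[mu]_(u in `]0%R, d[) (cos (pi / P * d) ^+ N.*2.+1) = d * cos (pi / P * d) ^+ N.*2.+1.
  by rewrite Rintegral_cst//= lebesgue_measure_itv/= lte_fin d0 -EFinD /= subr0 mulrC.
rewrite -dE; apply: le_Rintegral => //.
- by apply: integrable_continuous; exact: cst_continuous.
- by apply: integrable_continuous; apply: continuous_norm; exact: continuous_peak.
move=> u; rewrite /= in_itv/= => /andP[u0 ud].
rewrite normr_peakE; apply: lerXn2r; rewrite ?nnegrE//.
  by apply: cos_half_ge0; rewrite gtr0_norm.
by apply: le_trans (ler_norm _); apply: cos_decr; lra.
Qed.

Lemma peak_mass_gt0 N : 0 < peak_mass N.
Proof.
have P4 : 0 < P / 4 by rewrite divr_gt0.
have P42 : P / 4 <= P / 2 by lra.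
apply: (lt_le_trans _ (peak_mass_ge N P4 P42)).
rewrite mulr_gt0// exprn_gt0//.
apply: cos_gt0_pihalf; apply/andP; split.
  by apply: (@lt_trans _ _ 0); [rewrite oppr_lt0 divr_gt0// pi_gt0|rewrite mulr_gt0].
by rewrite pihalfP ltr_pM2l//; lra.
Qed.

(** The total mass is at least that of ]0, d/2[, on which the kernel exceeds a power
of cos (pi d / (2 P)); this number is greater than cos (pi d / P), so the ratio
decays geometrically. *)
Lemma peak_tail_cvg0 d : 0 < d -> d <= P / 2 ->
  cos (pi / P * d) ^+ N.*2.+1 / peak_mass N @[N --> \oo] --> (0 : R).
Proof.
move=> d0 dP.
set c1 := cos (pi / P * d); set c2 := cos (pi / P * (d / 2)).
have c10 : 0 <= c1 by apply: cos_half_ge0; rewrite gtr0_norm.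
have d20 : 0 <= d / 2 by lra.
have c12 : c1 < c2.
  by rewrite /c1 /c2 ltr_cos ?ltr_pM2l//; [|apply: in_0pi..]; lra.
have c20 : 0 < c2 by apply: le_lt_trans c12.
pose r := c1 / c2.
have r0 : 0 <= r by rewrite divr_ge0// ltW.
have r1 : r < 1 by rewrite ltr_pdivrMr// mul1r.
have cr : 2 / d * r ^+ N @[N --> \oo] --> (0 : R).
  rewrite -[X in _ --> X](mulr0 (2 / d)); apply: (cvgM (cvg_cst _)).
  by apply: cvg_expr; rewrite ger0_norm.
apply: squeeze_cvgr (cvg_cst (0 : R)) cr.
near=> N; apply/andP; split; first by rewrite divr_ge0 ?exprn_ge0// ltW// peak_mass_gt0.
rewrite ler_pdivrMr ?peak_mass_gt0//.
have d2 : 0 < d / 2 by lra.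
apply: (@le_trans _ _ (2 / d * r ^+ N * (d / 2 * c2 ^+ N.*2.+1))); last first.
  rewrite ler_wpM2l//; first by rewrite mulr_ge0 ?exprn_ge0// ltW// divr_gt0.
  by apply: peak_mass_ge => //; lra.
rewrite (_ : _ * _ = r ^+ N * c2 ^+ N.*2.+1); last by field; rewrite gt_eqF.
have -> : c1 ^+ N.*2.+1 = r ^+ N.*2.+1 * c2 ^+ N.*2.+1.
  by rewrite -exprMn /r divfK// gt_eqF.
rewrite ler_pM2r ?exprn_gt0//; apply: ler_wiXn2l => //; first exact: ltW.
by rewrite -addnn -addnS leq_addr.
Unshelve. all: by end_near. Qed.

End PeakKernel.

(** * Completeness of the trigonometric system *)

Section Completeness.
Context {R : realType}.
Notation mu := (@lebesgue_measure R).
Variable P : R.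
Hypothesis P0 : 0 < P.
Implicit Types (f g h : R -> R) (j k n N : nat) (M x e : R).
Local Notation D := (`]0, P[)%classic.

Let I0 N := peak_mass_gt0 P0 N.
Let cpeak N x : continuous (fun y => peak P N (x - y)).
Proof. by apply: continuous_reflect; exact: continuous_peak. Qed.

Lemma integral_normr_peak N x : 0 <= x -> x <= P ->
  \int[mu]_(y in D) `|peak P N (x - y)| = peak_mass P N.
Proof.
move=> x0 xP; apply: (@periodic_integral_reflect _ _ (fun u => `|peak P N u|)) => //.
  by apply: continuous_norm; exact: continuous_peak.
move=> u; rewrite !normr_peakE mulrDr divfK ?gt_eqF// cosDpi normrN//.
Qed.

Definition peak_mean h N (x : R) : R := (peak_mass P N)^-1 * convolution P h (peak P N) x.

Lemma peak_mean_le h M N x : measurable_fun D h -> (forall y, `|h y| <= M) -> 0 <= x -> x <= P ->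
  `|peak_mean h N x| <= M.
Proof.
move=> mh hM x0 xP.
have hh : L2_on D h.
  by apply: (@bounded_L2_on _ _ _ M) => //; exact: lebesgue_itvoo_lty.
rewrite /peak_mean normrM normfV (gtr0_norm (I0 N)) ler_pdivrMl//.
have hi := integrable_mul_continuous hh (@cpeak N x).
apply: le_trans (le_normr_Rintegral _ hi) _ => //.
rewrite mulrC -(integral_normr_peak N x0 xP) -RintegralZl//; last first.
  by apply: integrable_continuous; apply: continuous_norm; exact: cpeak.
apply: le_Rintegral => //.
- exact: integrable_norm.
- apply: integrable_scale => //.
  by apply: integrable_continuous; apply: continuous_norm; exact: cpeak.
- by move=> y _; rewrite normrM ler_wpM2r.
Qed.

(** Pointwise convergence inside the interval, with the uniform bound of
peak_mean_le, is enough for convergence in L2; at the end points the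
antiperiodic kernel would force a different limit. *)
Lemma peak_mean_cvg h M x : continuous h -> (forall y, `|h y| <= M) -> 0 < x < P ->
  peak_mean h N x @[N --> \oo] --> h x.
Proof.
move=> ch hM /andP[x0 xP].
have hh : L2_on D h by apply: continuous_L2_on; exact: continuous_subspaceT.
pose K N y := (peak_mass P N)^-1 * peak P N (x - y).
have cK N : continuous (K N) by move=> y; apply: cvgM; [exact: cvg_cst|exact: cpeak].
have Ki N : mu.-integrable D (EFin \o K N) by exact: integrable_continuous.
have nK N y : `|K N y| = (peak_mass P N)^-1 * `|peak P N (x - y)|.
  by rewrite /K normrM normfV (gtr0_norm (I0 N)).
have inpk N : mu.-integrable D (EFin \o (fun y => `|peak P N (x - y)|)).
  by apply: integrable_continuous; apply: continuous_norm; exact: cpeak.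
have ipk N : mu.-integrable D (EFin \o (fun y => peak P N (x - y))).
  by apply: integrable_continuous; exact: cpeak.
have nKi N : \int[mu]_(y in D) `|K N y| = 1.
  rewrite (eq_Rintegral_in (g := fun y => (peak_mass P N)^-1 * `|peak P N (x - y)|)); last by move=> y _.
  by rewrite RintegralZl// integral_normr_peak ?ltW// mulVf// gt_eqF.
(* d <= x and d <= P - x keep x - y at distance at least d from P and - P *)
have tail d N y : 0 < d -> d <= x -> d <= P - x -> D y -> d <= `|x - y| ->
    `|peak P N (x - y)| <= cos (pi / P * d) ^+ N.*2.+1.
  rewrite /= in_itv/= => d0 dx dPx /andP[y0 yP] dxy.
  have ? : `|x - y| <= P - d by rewrite ler_norml; apply/andP; split; lra.
  have ct : `|cos (pi / P * (x - y))| <= cos (pi / P * d) by apply: cos_tail => //; exact: ltW.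
  by rewrite normr_peakE lerXn2r// nnegrE// (le_trans _ ct).
have hE : (fun N => peak_mean h N x) = (fun N => \int[mu]_(y in D) (h y * K N y)).
  apply/funext => N; rewrite /peak_mean /convolution -RintegralZl//.
    by apply: eq_Rintegral_in => y _; rewrite mulrCA.
  exact: integrable_mul_continuous.
rewrite hE; apply: (@kernel_cvg _ _ _ _ _ 1) => //.
- exact: lebesgue_itvoo_lty.
- by move=> N; exact: integrable_mul_continuous.
- by move=> N; rewrite nKi.
(* within distance d of x the kernel is nonnegative, and it is small elsewhere in the interval *)
- pose d := Num.min (P / 2) (Num.min x (P - x)).
  have d0 : 0 < d by rewrite /d !lt_min; apply/and3P; split; lra.
  have [dP dx dPx] : [/\ d <= P / 2, d <= x & d <= P - x].
    by rewrite /d; split; rewrite !ge_min lexx ?orbT.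
  apply/subr_cvg0; apply/cvgr0Pnorm_le => e e0.
  have := peak_tail_cvg0 P0 d0 dP.
  have e2P : 0 < e / (2 * P) by rewrite divr_gt0// mulr_gt0.
  move=> /cvgr0Pnorm_le/(_ _ e2P); apply: filterS => N hN.
  rewrite -(nKi N) -RintegralB//; last exact: integrable_norm.
  have di : mu.-integrable D (EFin \o (fun y => K N y - `|K N y|)).
    by apply: integrable_sub => //; exact: integrable_norm.
  apply: le_trans (le_normr_Rintegral _ di) _ => //.
  have ci : mu.-integrable D (EFin \o (fun=> e / P)).
    by apply: integrable_continuous; exact: cst_continuous.
  apply: (@le_trans _ _ (\int[mu]_(y in D) (e / P))).
    apply: le_Rintegral => //; first exact: integrable_norm.
    move=> y Dy; have [dxy|xyd] := leP d `|x - y|.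
      have h1 := tail d N y d0 dx dPx Dy dxy.
      apply: (le_trans (ler_normB _ _)); rewrite normr_id -mulr2n -mulr_natr.
      rewrite (_ : e / P = e / (2 * P) * 2); last by field; rewrite gt_eqF.
      rewrite ler_pM2r//; apply: le_trans hN; apply: le_trans (ler_norm _).
      by rewrite nK mulrC ler_pM2r ?invr_gt0.
    have c0 : 0 <= cos (pi / P * (x - y)) by apply: cos_half_ge0 => //; lra.
    have K0 : 0 <= K N y by rewrite mulr_ge0 ?invr_ge0 ?(ltW (I0 N))//; exact: exprn_ge0.
    by rewrite (ger0_norm K0) subrr normr0 divr_ge0// ltW.
  rewrite Rintegral_cst//= lebesgue_measure_itv/= lte_fin P0 -EFinD /= subr0 divfK// gt_eqF//.
- move=> e e0.
  have /cvgrPdist_le/(_ e e0)[d' /= d'0 hd'] := ch x.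
  pose d := Num.min d' (Num.min (P / 2) (Num.min x (P - x))).
  have d0 : 0 < d by rewrite /d !lt_min d'0; apply/and3P; split; lra.
  have [dd' dP dx dPx] : [/\ d <= d', d <= P / 2, d <= x & d <= P - x].
    by rewrite /d; split; rewrite !ge_min lexx ?orbT.
  have := peak_tail_cvg0 P0 d0 dP.
  have M0 : 0 <= M by apply: le_trans (hM 0).
  have e2M : 0 < e / (2 * M + 1) by rewrite divr_gt0//; lra.
  move=> /cvgr0Pnorm_le/(_ _ e2M); apply: filterS => N hN y Dy.
  rewrite normrM; have [dxy|xyd] := leP d `|x - y|.
    have h1 := tail d N y d0 dx dPx Dy dxy.
    have KN : `|K N y| <= e / (2 * M + 1).
      apply: le_trans hN; apply: le_trans (ler_norm _).
      by rewrite nK mulrC ler_pM2r ?invr_gt0.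
    apply: (@le_trans _ _ ((2 * M + 1) * (e / (2 * M + 1)))).
      apply: ler_pM => //; apply: (le_trans (ler_normB _ _)).
      by have := hM y; have := hM x; lra.
    rewrite mulrC divfK; last by rewrite gt_eqF//; lra.
    by rewrite ler_pMr// lerDr.
  apply: ler_pM => //; last by rewrite lerDl.
  by rewrite distrC; apply: hd'; exact: lt_le_trans xyd dd'.
Qed.

Lemma trig_poly_peak_mean h N : L2_on D h -> trig_poly P (peak_mean h N).
Proof. by move=> hh; apply: trig_poly_scale; case: (smoothing_peak P N) => _; exact. Qed.

Lemma trig_poly_dense_continuous h M e : continuous h -> (forall y, `|h y| <= M) -> 0 < e ->
  exists N al, \int[mu]_(x in D) ((h x - lincomb (trig P) al N x) ^+ 2) <= e.
Proof.
move=> ch hM e0.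
have hh : L2_on D h by apply: continuous_L2_on; exact: continuous_subspaceT.
have mh : measurable_fun D h by case: hh.
have cpm N : continuous (peak_mean h N).
  have [n [al hE]] := trig_poly_peak_mean N hh.
  by rewrite (funext hE); exact: continuous_lincomb_trig.
have cd N : continuous (fun x => (h x - peak_mean h N x) ^+ 2).
  move=> x; apply: (@cvgM _ _ _ _ (fun x => h x - peak_mean h N x) (fun x => h x - peak_mean h N x));
    by apply: cvgB; [exact: ch|exact: cpm].
have M0 : 0 <= M by apply: le_trans (hM 0).
have : \int[mu]_(x in D) ((h x - peak_mean h N x) ^+ 2) @[N --> \oo] --> \int[mu]_(x in D) (0 : R).
  apply: (@Rintegral_dominated_cvg _ _ _ _ (fun=> (2 * M) ^+ 2)) => //.
  - by move=> N; apply: measurable_funS (continuous_measurable_fun (cd N)).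
  - move=> x; rewrite /= in_itv/= => xP.
    have h0 : h x - peak_mean h N x @[N --> \oo] --> (0 : R).
      rewrite -[X in _ --> X](subrr (h x)); apply: (cvgB (cvg_cst _)).
      exact: peak_mean_cvg ch hM xP.
    by rewrite -[X in _ --> X](mulr0 (0 : R)); exact: (cvgM h0 h0).
  - move=> N x; rewrite /= in_itv/= => /andP[x0 xP].
    have h1 := peak_mean_le N mh hM (ltW x0) (ltW xP); have h2 := hM x.
    rewrite normrX lerXn2r ?nnegrE ?mulr_ge0// (le_trans (ler_normB _ _))//; lra.
  - by apply: integrable_continuous; exact: cst_continuous.
  - by apply: integrable_continuous; exact: cst_continuous.
rewrite Rintegral_cst// mul0r => /cvgr0Pnorm_le/(_ _ e0)[n _ hn].
have [N [al hE]] := trig_poly_peak_mean n hh.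
exists N, al; have := hn n (leqnn n); rewrite /= => h1.
by rewrite (eq_Rintegral_in (g := fun x => (h x - peak_mean h n x) ^+ 2)) ?(le_trans (ler_norm _) h1)// => x _; rewrite hE.
Qed.

End Completeness.

Section Parseval.
Context {R : realType}.
Notation mu := (@lebesgue_measure R).
Implicit Types (f g h : R -> R) (j k n N : nat) (M x e a b c : R).

(** Truncation at height M.  It is a contraction, so it does not spoil an
approximation in L1, and for bounded functions closeness in L1 gives closeness
in L2. *)
Definition clamp M x : R := Num.max (- M) (Num.min M x).

Lemma clamp_le M x : 0 <= M -> `|clamp M x| <= M.
Proof.
by move=> M0; rewrite ler_norml /clamp le_max lexx ge_max ge_min lexx andbT /=; lra.
Qed.

Lemma continuous_clamp M : continuous (clamp M).
Proof.
move=> x; apply: (@continuous_max _ _ (fun=> - M) (fun x => Num.min M x)).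
  exact: cvg_cst.
by apply: (@continuous_min _ _ (fun=> M) id); [exact: cvg_cst|exact: cvg_id].
Qed.

Lemma clamp_lip M x y : `|clamp M x - clamp M y| <= `|x - y|.
Proof.
have := ler_norm (x - y); have := ler_norm (y - x); rewrite distrC.
move: `|x - y| => d h1 h2; rewrite ler_norml /clamp.
by case: (leP M x) => ?; case: (leP M y) => ?;
  repeat match goal with |- context[Num.max ?u ?v] => case: (leP u v) => ? end;
  apply/andP; split; lra.
Qed.

Lemma clamp_dist M x : 0 <= M -> `|x - clamp M x| <= `|x|.
Proof.
move=> M0; have := ler_norm x; have := ler_norm (- x); rewrite normrN.
move: `|x| => d h1 h2; rewrite ler_norml /clamp.
by case: (leP M x) => ?;
  repeat match goal with |- context[Num.max ?u ?v] => case: (leP u v) => ? end;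
  apply/andP; split; lra.
Qed.

Lemma clamp_id M x : `|x| <= M -> clamp M x = x.
Proof.
by rewrite ler_norml /clamp => /andP[h1 h2]; rewrite min_r// max_r.
Qed.

Lemma integral_sqr_sub_trans D f g h : measurable D -> L2_on D f -> L2_on D g -> L2_on D h ->
  \int[mu]_(x in D) ((f x - h x) ^+ 2) <=
  2 * \int[mu]_(x in D) ((f x - g x) ^+ 2) + 2 * \int[mu]_(x in D) ((g x - h x) ^+ 2).
Proof.
move=> mD hf hg hh.
have [_ ifg] := L2_on_sub mD hf hg.
have [_ igh] := L2_on_sub mD hg hh.
have [_ ifh] := L2_on_sub mD hf hh.
rewrite -!RintegralZl// -RintegralD//; [|exact: integrable_scale..].
apply: le_Rintegral => //; first by apply: integrable_add => //; exact: integrable_scale.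
move=> x _; have := sqr_ge0 (f x - g x - (g x - h x)); nra.
Qed.

(** First f is truncated, by dominated convergence; then the truncation is
approximated in L1 by a continuous function, which is truncated in turn. *)
Lemma continuous_dense_L2 D f e : measurable D -> (mu D < +oo)%E -> L2_on D f -> 0 < e ->
  exists M h, [/\ continuous h, forall x, `|h x| <= M &
    \int[mu]_(x in D) ((f x - h x) ^+ 2) <= e].
Proof.
move=> mD Dfin hf e0; have [mf if2] := hf.
have mclamp n : measurable_fun D (fun x => clamp n%:R (f x)).
  apply: measurableT_comp => //; exact: continuous_measurable_fun (@continuous_clamp _).
have [n hn] : exists n, \int[mu]_(x in D) ((f x - clamp n%:R (f x)) ^+ 2) <= e / 4.
  have : \int[mu]_(x in D) ((f x - clamp n%:R (f x)) ^+ 2) @[n --> \oo] --> \int[mu]_(x in D) (0 : R).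
    apply: (@Rintegral_dominated_cvg _ _ _ _ (fun x => f x ^+ 2)) => //.
    - by move=> n; apply: measurable_funX; exact: (measurable_funB mf (mclamp n)).
    - move=> x Dx; apply: cvg_near_cst; near=> n.
      rewrite clamp_id ?subrr ?expr0n//.
      near: n; exists (Num.truncn `|f x|).+1 => // n /= hn.
      by rewrite ltW// (lt_le_trans (truncnS_gt _))// ler_nat.
    - move=> n x _; rewrite normrX -[leRHS]real_normK ?num_real// lerXn2r ?nnegrE//.
      exact: clamp_dist.
    - apply: (@bounded_integrable _ _ _ 0) => // x _; rewrite normr0//.
  rewrite Rintegral_cst// mul0r.
  have e4 : 0 < e / 4 by lra.
  move=> /cvgr0Pnorm_le/(_ _ e4)[n _ hn]; exists n.
  exact: le_trans (ler_norm _) (hn n (leqnn n)).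
pose M : R := n%:R; have M0 : 0 <= M by [].
pose fM x := clamp M (f x).
have hfM : L2_on D fM.
  exact: (bounded_L2_on mD Dfin (mclamp n) (fun x _ => clamp_le (f x) M0)).
have ifM := L2_on_integrable mD Dfin hfM.
have [g_ [cg ig cvg_g]] : exists g_ : nat -> R -> R, [/\ forall n, continuous (g_ n),
    forall n, mu.-integrable D (EFin \o g_ n) &
    (\int[mu]_(z in D) `|(fM z - g_ n z)%:E|)%E @[n --> \oo] --> 0%E].
  by have [g_ ?] := approximation_continuous_integrable mD Dfin ifM; exists g_.
have C0 : 0 < e / (8 * M + 1) by rewrite divr_gt0//; lra.
have [m hm] : exists m, \int[mu]_(x in D) `|fM x - g_ m x| <= e / (8 * M + 1).
  have : \int[mu]_(x in D) `|fM x - g_ m x| @[m --> \oo] --> (0 : R).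
    by apply: fine_cvg; exact: cvg_g.
  move=> /cvgr0Pnorm_le/(_ _ C0)[m _ hm]; exists m.
  by apply: le_trans (hm m (leqnn m)); rewrite ler_norm.
exists M, (fun x => clamp M (g_ m x)).
have cc : continuous (fun x => clamp M (g_ m x)).
  by move=> x; apply: continuous_comp; [exact: cg|exact: continuous_clamp].
have hc : L2_on D (fun x => clamp M (g_ m x)).
  apply: (@bounded_L2_on _ _ _ M) => //.
    by apply: measurable_funS (continuous_measurable_fun cc).
  by move=> x _; exact: clamp_le.
split => //; first by move=> x; exact: clamp_le.
apply: le_trans (integral_sqr_sub_trans mD hf hfM hc) _.
suff : \int[mu]_(x in D) ((fM x - clamp M (g_ m x)) ^+ 2) <= e / 4.
  by move: hn; rewrite -/M /fM; lra.
have idiff : mu.-integrable D (EFin \o (fun x => `|fM x - g_ m x|)).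
  by apply: integrable_norm => //; apply: integrable_sub.
apply: (@le_trans _ _ (\int[mu]_(x in D) (2 * M * `|fM x - g_ m x|))).
  apply: le_Rintegral => //.
  - by have [] := L2_on_sub mD hfM hc.
  - exact: integrable_scale.
  move=> x _; rewrite -real_normK ?num_real// expr2.
  apply: ler_pM => //.
    apply: (le_trans (ler_normB _ _)).
    by have := clamp_le (f x) M0; have := clamp_le (g_ m x) M0; rewrite /fM; lra.
  have fMK : fM x = clamp M (fM x) by rewrite clamp_id//; exact: clamp_le.
  by rewrite [X in `|X - _|]fMK clamp_lip.
rewrite RintegralZl//.
apply: (@le_trans _ _ (2 * M * (e / (8 * M + 1)))); first by apply: ler_wpM2l => //; lra.
rewrite mulrA ler_pdivrMr; last by lra.
by nra.
Unshelve. all: by end_near. Qed.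

Lemma trig_poly_dense P g e : 0 < P -> L2_on `]0, P[ g -> 0 < e ->
  exists N al, \int[mu]_(x in `]0, P[) ((g x - lincomb (trig P) al N x) ^+ 2) <= e.
Proof.
move=> P0 hg e0; have e4 : 0 < e / 4 by lra.
have [M [h [ch hM gh]]] := continuous_dense_L2 (measurable_itv _) (lebesgue_itvoo_lty 0 P) hg e4.
have [N [al hT]] := trig_poly_dense_continuous P0 ch hM e4.
exists N, al.
have hh : L2_on `]0, P[ h by apply: continuous_L2_on; exact: continuous_subspaceT.
have hl : L2_on `]0, P[ (lincomb (trig P) al N).
  by apply: continuous_L2_on; apply: continuous_subspaceT; exact: continuous_lincomb_trig.
by apply: le_trans (integral_sqr_sub_trans _ hg hh hl) _ => //; lra.
Qed.

Lemma trig_parseval P g : 0 < P -> L2_on `]0, P[ g ->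
  2 / P * \sum_(n < N)
     ((\int[mu]_(x in `]0, P[) (g x * cos (freq P n * x))) ^+ 2 +
      (\int[mu]_(x in `]0, P[) (g x * sin (freq P n * x))) ^+ 2) @[N --> \oo] -->
  \int[mu]_(x in `]0, P[) (g x ^+ 2).
Proof.
move=> P0 hg.
have P20 : 0 < P / 2 by rewrite divr_gt0.
have htrig k : L2_on `]0, P[ (trig P k).
  by apply: continuous_L2_on; apply: continuous_subspaceT; exact: continuous_trig.
have dense e : 0 < e -> exists N al,
    \int[mu]_(x in `]0, P[) ((g x - lincomb (trig P) al N x) ^+ 2) <= e.
  exact: trig_poly_dense.
have := parseval_of_dense (measurable_itv _) P20 htrig (integral_trig_mul P0) hg dense.
set b := fun k => \int[mu]_(x in `]0, P[) (g x * trig P k x).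
move=> hcvg.
have sumE N : 2 / P * \sum_(n < N)
     ((\int[mu]_(x in `]0, P[) (g x * cos (freq P n * x))) ^+ 2 +
      (\int[mu]_(x in `]0, P[) (g x * sin (freq P n * x))) ^+ 2) =
   (P / 2)^-1 * \sum_(k < N.*2) b k ^+ 2.
  rewrite invf_div; congr (_ * _); elim: N => [|N IH]; first by rewrite !big_ord0.
  rewrite doubleS !big_ord_recr/= IH -addrA /b; congr (_ + (_ ^+ 2 + _ ^+ 2)).
    by apply: eq_Rintegral_in => x _; rewrite trig_double.
  by apply: eq_Rintegral_in => x _; rewrite trig_doubleS.
rewrite (funext sumE).
apply: (cvg_comp (fun N => N.*2) (fun n => (P / 2)^-1 * \sum_(k < n) b k ^+ 2) _ hcvg).
by move=> A [n _ hA]; exists n => // k /= nk; apply: hA; rewrite /= -addnn (leq_trans nk)// leq_addr.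
Qed.

End Parseval.

(** * Weak evolution in time *)

Section Pairing.
Context {R : realType}.
Notation mu := (@lebesgue_measure R).
Implicit Types (f g h k : R -> R) (x e a b t : R).

Lemma sqdist_L2_fin a b f g : L2_on `]a, b[ f -> L2_on `]a, b[ g ->
  sqdist_L2 a b f g = (\int[mu]_(x in `]a, b[) ((f x - g x) ^+ 2))%:E.
Proof.
move=> hf hg; have [_ hi] := L2_on_sub (measurable_itv _) hf hg.
by rewrite /sqdist_L2 /Rintegral fineK//; exact: integrable_fin_num.
Qed.

(** Convergence in L2 implies weak convergence, by Cauchy-Schwarz. *)
Lemma L2_cvg_pairing {T : Type} (F : set_system T) {FF : Filter F} a b
    (u : T -> R -> R) f k :
  F [set s | L2_on `]a, b[ (u s)] -> L2_on `]a, b[ f -> L2_on `]a, b[ k ->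
  sqdist_L2 a b (u s) f @[s --> F] --> 0%E ->
  \int[mu]_(x in `]a, b[) (u s x * k x) @[s --> F] --> \int[mu]_(x in `]a, b[) (f x * k x).
Proof.
move=> hu hf hk hcv; pose D : set R := `]a, b[%classic.
pose K := \int[mu]_(x in D) (k x ^+ 2).
have K0 : 0 <= K by apply: Rintegral_ge0 => x _; exact: sqr_ge0.
apply/subr_cvg0; apply/cvgr0Pnorm_le => e e0.
have eK : 0 < e ^+ 2 / (K + 1) by rewrite divr_gt0 ?exprn_gt0//; lra.
have : fine (sqdist_L2 a b (u s) f) @[s --> F] --> (0 : R) by apply: fine_cvg; exact: hcv.
move=> /cvgr0Pnorm_le/(_ _ eK).
apply: filterS2 hu => s hus /=; rewrite sqdist_L2_fin// => hs.
have hd := L2_on_sub (measurable_itv _) hus hf.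
have hle : \int[mu]_(x in D) ((u s x - f x) ^+ 2) <= e ^+ 2 / (K + 1).
  exact: le_trans (ler_norm _) hs.
rewrite -RintegralB//; [|exact: L2_on_mul_integrable..].
rewrite (eq_Rintegral_in (g := fun x => (u s x - f x) * k x)); last by move=> x _; rewrite mulrBl.
rewrite -ler_sqr ?nnegrE ?(ltW e0)// real_normK ?num_real//.
apply: le_trans (sqr_integral_mul_le (measurable_itv _) hd hk) _.
apply: (@le_trans _ _ (e ^+ 2 / (K + 1) * (K + 1))); last by rewrite divfK// gt_eqF//; lra.
by apply: ler_pM => //; [apply: Rintegral_ge0 => x _; exact: sqr_ge0|rewrite /K lerDl].
Qed.

End Pairing.

Section TimeFunctions.
Context {R : realType}.
Notation mu := (@lebesgue_measure R).
Implicit Types (w : R -> R) (t T lam : R).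

Definition continuous_nonneg w := forall t, 0 <= t ->
  w s @[s --> within [set s | 0 <= s] (nbhs t)] --> w t.

Lemma continuous_nonneg_itv w T : continuous_nonneg w -> {within `[0, T], continuous w}.
Proof.
move=> cw; apply/subspace_continuousP => t; rewrite /= in_itv/= => /andP[t0 tT].
apply: cvg_trans (cw t t0); apply: cvg_fmap2; apply: within_subset => s.
by rewrite /= in_itv/= => /andP[].
Qed.

Lemma continuous_nonneg_add w1 w2 : continuous_nonneg w1 -> continuous_nonneg w2 ->
  continuous_nonneg (fun t => w1 t + w2 t).
Proof. by move=> c1 c2 t t0; apply: cvgD; [exact: c1|exact: c2]. Qed.

Lemma continuous_nonneg_scale c w : continuous_nonneg w -> continuous_nonneg (fun t => c * w t).
Proof. by move=> cw t t0; apply: cvgM; [exact: cvg_cst|exact: cw]. Qed.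

Lemma continuous_nonneg_integrable w psi T : continuous_nonneg w -> continuous psi ->
  mu.-integrable `]0, T[ (EFin \o (fun t => w t * psi t)).
Proof.
move=> cw cpsi; apply: integrable_mul_continuous => //; apply: continuous_L2_on.
exact: continuous_nonneg_itv.
Qed.

(** A weak formulation of w' on ]0, +oo[, with the value at time 0 built in; it is
stable under sums and under the two ways in which derivatives arise below. *)
Definition time_derivative w w' := forall T psi psi', 0 < T -> C1_deriv psi psi' ->
  \int[mu]_(t in `]0, T[) (w t * psi' t) + \int[mu]_(t in `]0, T[) (w' t * psi t) =
  w T * psi T - w 0 * psi 0.

Lemma time_derivative_add w1 w1' w2 w2' :
  continuous_nonneg w1 -> continuous_nonneg w1' ->
  continuous_nonneg w2 -> continuous_nonneg w2' ->
  time_derivative w1 w1' -> time_derivative w2 w2' ->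
  time_derivative (fun t => w1 t + w2 t) (fun t => w1' t + w2' t).
Proof.
move=> c1 c1' c2 c2' d1 d2 T psi psi' T0 hpsi.
have cpsi := C1_deriv_continuous hpsi; have [_ cpsi'] := hpsi.
have := d1 T psi psi' T0 hpsi; have := d2 T psi psi' T0 hpsi.
rewrite (eq_Rintegral_in (f := fun t => (w1 t + w2 t) * _) (g := fun t => w1 t * psi' t + w2 t * psi' t));
  last by move=> t _; rewrite mulrDl.
rewrite (eq_Rintegral_in (f := fun t => (w1' t + w2' t) * _) (g := fun t => w1' t * psi t + w2' t * psi t));
  last by move=> t _; rewrite mulrDl.
rewrite !RintegralD//; [|exact: continuous_nonneg_integrable..].
by rewrite !mulrDl => h1 h2; lra.
Qed.

Lemma is_derive_time_derivative w w' : continuous_nonneg w -> continuous_nonneg w' ->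
  (forall t, 0 < t -> is_derive t (1 : R) w (w' t)) -> time_derivative w w'.
Proof.
move=> cw cw' dw T psi psi' T0 hpsi.
have cpsi := C1_deriv_continuous hpsi; have [dpsi cpsi'] := hpsi.
pose f t := w t * psi' t + w' t * psi t.
have cf : {within `[0, T], continuous f}.
  move=> t; apply: cvgD; apply: cvgM.
  - exact: (continuous_nonneg_itv cw).
  - by apply: continuous_subspaceT.
  - exact: (continuous_nonneg_itv cw').
  - by apply: continuous_subspaceT.
have cF : {within `[0, T], continuous (fun t => w t * psi t)}.
  move=> t; apply: cvgM; first exact: (continuous_nonneg_itv cw).
  by apply: continuous_subspaceT.
have dF t : 0 < t -> is_derive t (1 : R) (fun t => w t * psi t) (f t).
  move=> t0; apply: is_derive_congr (is_deriveM (dw t t0) (dpsi t)) _.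
  by rewrite /f /= /GRing.scale /= [psi t * _]mulrC.
have [_ F0 FT] := (continuous_within_itvP _ T0).1 cF.
rewrite -RintegralD//; [|exact: continuous_nonneg_integrable..].
rewrite -Rintegral_itv_cc_oo; last exact: continuous_itv_integrable.
rewrite /Rintegral (@continuous_FTC2 _ f (fun t => w t * psi t))//.
  by split => // t; rewrite in_itv/= => /andP[t0 _]; case: (dF t t0).
move=> t; rewrite in_itv/= => /andP[t0 _].
by rewrite derive1E; exact: (@derive_val _ _ _ _ _ _ _ (dF t t0)).
Qed.

Lemma weak_time_derivative w w' : continuous_nonneg w -> continuous_nonneg w' ->
  (forall T, 0 < T -> weak_derivative 0 T w w') -> time_derivative w w'.
Proof.
move=> cw cw' wd T psi psi' T0 hpsi.
apply: weak_derivative_by_parts => //.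
- exact: continuous_nonneg_itv.
- by apply: continuous_L2_on; exact: continuous_nonneg_itv.
- exact: wd.
Qed.

(** With psi = cos (lam t) and psi = sin (lam t) the integrals cancel in pairs, and the
boundary terms say that (X, Y) at time T is (X, Y) at time 0 turned by the angle
lam T. *)
Lemma rotation_conserved lam X Y : continuous_nonneg X -> continuous_nonneg Y ->
  time_derivative X (fun t => lam * Y t) -> time_derivative Y (fun t => - lam * X t) ->
  forall T, 0 <= T -> X T ^+ 2 + Y T ^+ 2 = X 0 ^+ 2 + Y 0 ^+ 2.
Proof.
move=> cX cY dX dY T; rewrite le_eqVlt => /predU1P[<-//|T0].
have affE x : affine lam 0 x = lam * x by rewrite /affine addr0.
have hc : C1_deriv (fun t => cos (lam * t)) (fun t => lam * - sin (lam * t)).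
  have := C1_deriv_affine lam 0 (@C1_deriv_cos R).
  by congr C1_deriv; apply/funext => x /=; rewrite affE.
have hs : C1_deriv (fun t => sin (lam * t)) (fun t => lam * cos (lam * t)).
  have := C1_deriv_affine lam 0 (@C1_deriv_sin R).
  by congr C1_deriv; apply/funext => x /=; rewrite affE.
have iZ w psi c : continuous_nonneg w -> continuous psi ->
    \int[mu]_(t in `]0, T[) (c * (w t * psi t)) = c * \int[mu]_(t in `]0, T[) (w t * psi t).
  by move=> cw cp; rewrite RintegralZl//; exact: continuous_nonneg_integrable.
have csin : continuous (fun t => sin (lam * t)) by exact: C1_deriv_continuous hs.
have ccos : continuous (fun t => cos (lam * t)) by exact: C1_deriv_continuous hc.
have red w (c : R) (p q : R -> R) : continuous_nonneg w -> continuous q ->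
    (forall t, p t = c * q t) ->
    \int[mu]_(t in `]0, T[) (w t * p t) = c * \int[mu]_(t in `]0, T[) (w t * q t).
  by move=> cw cq pq; rewrite -iZ//; apply: eq_Rintegral_in => t _; rewrite pq; ring.
have red' w (c : R) (q : R -> R) : continuous_nonneg w -> continuous q ->
    \int[mu]_(t in `]0, T[) (c * w t * q t) = c * \int[mu]_(t in `]0, T[) (w t * q t).
  by move=> cw cq; rewrite -iZ//; apply: eq_Rintegral_in => t _; ring.
have := dX T _ _ T0 hc; have := dX T _ _ T0 hs; have := dY T _ _ T0 hc; have := dY T _ _ T0 hs.
rewrite !red' //.
have redS w : continuous_nonneg w -> \int[mu]_(t in `]0, T[) (w t * (lam * - sin (lam * t))) =
    - lam * \int[mu]_(t in `]0, T[) (w t * sin (lam * t)).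
  by move=> cw; apply: red => // t; ring.
have redC w : continuous_nonneg w -> \int[mu]_(t in `]0, T[) (w t * (lam * cos (lam * t))) =
    lam * \int[mu]_(t in `]0, T[) (w t * cos (lam * t)).
  by move=> cw; apply: red.
rewrite !redS// !redC//.
rewrite !mulr0 sin0 cos0 !mulr0 !mulr1.
move=> e1 e2 e3 e4.
have E1 : X 0 = X T * cos (lam * T) - Y T * sin (lam * T) by lra.
have E2 : Y 0 = Y T * cos (lam * T) + X T * sin (lam * T) by lra.
rewrite E1 E2; have := cos2Dsin2 (lam * T); move: (cos _) (sin _) => c s cs.
by rewrite -[LHS]mulr1 -cs; ring.
Qed.

End TimeFunctions.

(** * The moving string in its own frame *)

Lemma Rintegral_support {R : realType} (D D' : set R) (f : R -> R) : D' `<=` D ->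
  (forall x, D x -> ~ D' x -> f x = 0) ->
  \int[@lebesgue_measure R]_(x in D) f x = \int[@lebesgue_measure R]_(x in D') f x.
Proof.
move=> D'D f0; rewrite Rintegral_mkcond [RHS]Rintegral_mkcond; congr Rintegral.
apply/funext => x; rewrite !patchE.
case: ifPn => xD; case: ifPn => xD' //.
  by apply: f0; [exact/set_mem|move=> /mem_set; exact/negP].
by move: xD; rewrite mem_set//; apply: D'D; exact/set_mem.
Qed.

Section String.
Context {R : realType}.
Notation mu := (@lebesgue_measure R).
Variables (L v : R).
Hypothesis L0 : 0 < L.
Implicit Types (F : R -> R -> R) (f g h k psi theta : R -> R) (x e a b t : R).
Local Notation D := (`]0, L[)%classic.

Lemma preimage_I_ t : affine 1 (v * t) @^-1` (I_ L v t) = D.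
Proof.
by rewrite /I_ affine_preimage_itvoo// !divr1 subrr addrK.
Qed.

Lemma slice_affine F t : slice v F t = (F^~ t) \o affine 1 (v * t).
Proof. by apply/funext => y; rewrite /slice /affine /= mul1r. Qed.

Lemma L2_on_slice F t : L2_on (I_ L v t) (F^~ t) -> L2_on D (slice v F t).
Proof.
move=> hF; rewrite -(preimage_I_ t) slice_affine.
exact: (L2_on_affine (v * t) (oner_neq0 R) (measurable_itv _) hF).
Qed.

(** In the frame of the string the domain of integration is fixed, so that
continuity in L2 of the slices passes to the pairing. *)
Definition pairing F k t : R := \int[mu]_(y in D) (slice v F t y * k y).

Lemma pairing_translate F k t : L2_on (I_ L v t) (F^~ t) -> continuous k ->
  \int[mu]_(x in I_ L v t) (F x t * k (x - v * t)) = pairing F k t.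
Proof.
move=> hF ck; have ck' : continuous (fun x => k (x - v * t)).
  move=> x; apply: (@continuous_comp _ _ _ (fun x => x - v * t)); last exact: ck.
  by apply: cvgB; [exact: cvg_id|exact: cvg_cst].
have hi := integrable_mul_continuous hF ck'.
rewrite (Rintegral_affine (v * t) (oner_neq0 R) (measurable_itv _) hi).
rewrite normr1 mul1r preimage_I_; apply: eq_Rintegral_in => y _.
by rewrite /slice /affine mul1r addrK.
Qed.

Lemma continuous_nonneg_eq (w1 w2 : R -> R) : (forall t, 0 <= t -> w1 t = w2 t) ->
  continuous_nonneg w1 -> continuous_nonneg w2.
Proof.
move=> w12 c1 t t0; rewrite -w12//; apply: cvg_trans (c1 t t0).
apply: near_eq_cvg; rewrite near_withinE; apply: nearW => s s0; exact: w12.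
Qed.

Lemma continuous_nonneg_pairing F k :
  (forall t, 0 <= t -> L2_on D (slice v F t)) -> L2_on D k ->
  (forall t, 0 <= t -> sqdist_L2 0 L (slice v F s) (slice v F t)
     @[s --> within [set s | 0 <= s] (nbhs t)] --> 0%E) ->
  continuous_nonneg (pairing F k).
Proof.
move=> hF hk cF t t0; apply: (L2_cvg_pairing _ (hF t t0) hk (cF t t0)).
by apply: nearW => s; exact: hF.
Qed.

Lemma continuous_L2_on_string k : continuous k -> L2_on D k.
Proof. by move=> ck; apply: continuous_L2_on; exact: continuous_subspaceT. Qed.

(** Test functions that move with the string separate the variables: derivatives in
time and space reduce to theta' and k'. *)
Lemma test_fun_separated theta theta' k k' T : C1c 0 T theta -> C1_deriv theta theta' ->
  C1_deriv k k' -> k L = 0 ->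
  test_fun L v (fun x t => theta t * k (x - v * t)) /\
  forall x t, pdx (fun x t => theta t * k (x - v * t)) x t = theta t * k' (x - v * t) /\
   pdt (fun x t => theta t * k (x - v * t)) x t =
     theta' t * k (x - v * t) - v * theta t * k' (x - v * t).
Proof.
move=> [_ _ [c [d [c0 cd dT thout]]]] hth hk kL.
pose psi x t := theta t * k (x - v * t).
have cth := C1_deriv_continuous hth; have ck := C1_deriv_continuous hk.
have [_ cth'] := hth; have [_ ck'] := hk.
have hx t : C1_deriv (psi^~ t) (fun x => theta t * k' (x - v * t)).
  have := C1_deriv_scale (theta t) (C1_deriv_affine 1 (- (v * t)) hk).
  by congr C1_deriv; apply/funext => x; rewrite /affine /= !mul1r.
have ht x : C1_deriv (psi x) (fun t => theta' t * k (x - v * t) - v * theta t * k' (x - v * t)).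
  have := C1_deriv_mul hth (C1_deriv_affine (- v) x hk).
  have e t : affine (- v) x t = x - v * t by rewrite /affine; ring.
  by congr C1_deriv; apply/funext => t; rewrite /= e//; ring.
have pdxE x t : pdx psi x t = theta t * k' (x - v * t).
  by rewrite /pdx (C1_deriv_derive1 (hx t)).
have pdtE x t : pdt psi x t = theta' t * k (x - v * t) - v * theta t * k' (x - v * t).
  by rewrite /pdt (C1_deriv_derive1 (ht x)).
have carg : continuous (fun z : R * R => z.1 - v * z.2).
  move=> z; apply: cvgB; first exact: cvg_fst.
  by apply: cvgM; [exact: cvg_cst|exact: cvg_snd].
have csnd f : continuous f -> continuous (fun z : R * R => f z.2).
  by move=> cf z; apply: (@continuous_comp _ _ _ (fun z : R * R => z.2)); [exact: cvg_snd|exact: cf].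
have ccarg f : continuous f -> continuous (fun z : R * R => f (z.1 - v * z.2)).
  by move=> cf z; apply: (@continuous_comp _ _ _ (fun z : R * R => z.1 - v * z.2)); [exact: carg|exact: cf].
split; last by [].
split.
- split.
  + by move=> x t; exact: (C1_deriv_derivable (hx t)).
  + by move=> x t; exact: (C1_deriv_derivable (ht x)).
  + rewrite (_ : (fun z : R * R => pdx _ z.1 z.2) =
      (fun z => theta z.2 * k' (z.1 - v * z.2))); last by apply/funext => z; rewrite pdxE.
    by move=> z; apply: cvgM; [exact: csnd|exact: ccarg].
  + rewrite (_ : (fun z : R * R => pdt _ z.1 z.2) =
      (fun z => theta' z.2 * k (z.1 - v * z.2) - v * theta z.2 * k' (z.1 - v * z.2)));
      last by apply/funext => z; rewrite pdtE.
    move=> z; apply: cvgB; apply: cvgM; [exact: csnd|exact: ccarg| |exact: ccarg].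
    by apply: cvgM; [exact: cvg_cst|exact: csnd].
- by move=> t; rewrite addrK kL mulr0.
- by exists c, d; split => // x t xt; rewrite thout// mul0r.
Qed.

Variables (phi0 phi1 : R -> R) (phi phix phit : R -> R -> R).
Hypothesis hphi : WP_solution L v phi0 phi1 phi phix phit.

Let Dphi x t := phit x t + v * phix x t.

Lemma L2_phit t : 0 <= t -> L2_on (I_ L v t) (phit^~ t).
Proof. by move=> t0; have [] := WP_C1 hphi t0. Qed.

Lemma L2_phix t : 0 <= t -> L2_on (I_ L v t) (phix^~ t).
Proof. by move=> t0; have [[]] := WP_H1 hphi t0. Qed.

Lemma L2_phi t : 0 <= t -> L2_on (I_ L v t) (phi^~ t).
Proof. by move=> t0; have [[]] := WP_H1 hphi t0. Qed.

Let L2_st t : 0 <= t -> L2_on D (slice v phit t).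
Proof. by move=> t0; apply: L2_on_slice; exact: L2_phit. Qed.

Let L2_sx t : 0 <= t -> L2_on D (slice v phix t).
Proof. by move=> t0; apply: L2_on_slice; exact: L2_phix. Qed.

Let L2_s t : 0 <= t -> L2_on D (slice v phi t).
Proof. by move=> t0; apply: L2_on_slice; exact: L2_phi. Qed.

Let L2_sD t : 0 <= t -> L2_on D (slice v Dphi t).
Proof.
move=> t0; apply: (L2_on_add _ (L2_st t0) (L2_on_scale v _ (L2_sx t0)));
  exact: measurable_itv.
Qed.

(** The material derivative, along the motion of the string, is phi_t + v phi_x. *)
Lemma pairing_material k t : L2_on D k -> 0 <= t ->
  pairing Dphi k t = pairing phit k t + v * pairing phix k t.
Proof.
move=> hk t0; rewrite /pairing -RintegralZl//; last by apply: L2_on_mul_integrable => //; exact: L2_sx.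
rewrite -RintegralD//.
- by apply: eq_Rintegral_in => y _; rewrite /slice /Dphi; ring.
- by apply: L2_on_mul_integrable => //; exact: L2_st.
- by apply: integrable_scale => //; apply: L2_on_mul_integrable => //; exact: L2_sx.
Qed.

Lemma continuous_pairing_material k : L2_on D k -> continuous_nonneg (pairing Dphi k).
Proof.
move=> hk; apply: continuous_nonneg_pairing => // t t0.
by have [_ _] := WP_C1 hphi t0.
Qed.

Let sqdist_ge0 a b f g : (0 <= sqdist_L2 a b f g)%E.
Proof. by apply: integral_ge0 => x _; rewrite lee_fin sqr_ge0. Qed.

Lemma continuous_pairing_x k : L2_on D k -> continuous_nonneg (pairing phix k).
Proof.
move=> hk; apply: continuous_nonneg_pairing => // t t0.
apply: squeeze_cvge (cvg_cst 0%E) (WP_continuous hphi t0).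
by apply: nearW => s; rewrite sqdist_ge0 leeDr.
Qed.

Lemma continuous_pairing k : L2_on D k -> continuous_nonneg (pairing phi k).
Proof.
move=> hk; apply: continuous_nonneg_pairing => // t t0.
apply: squeeze_cvge (cvg_cst 0%E) (WP_continuous hphi t0).
by apply: nearW => s; rewrite sqdist_ge0 leeDl.
Qed.

Lemma continuous_pairing_t k : L2_on D k -> continuous_nonneg (pairing phit k).
Proof.
move=> hk; apply: (@continuous_nonneg_eq (fun t => pairing Dphi k t + - v * pairing phix k t)).
  by move=> t t0; rewrite pairing_material//; ring.
apply: continuous_nonneg_add; first exact: continuous_pairing_material.
by apply: continuous_nonneg_scale; exact: continuous_pairing_x.
Qed.

(** This is where phi enters as a C1 function of time with values in L2: difference
quotients converge in L2, hence against k. *)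
Lemma is_derive_pairing k t : L2_on D k -> 0 < t ->
  is_derive t (1 : R) (pairing phi k) (pairing Dphi k t).
Proof.
move=> hk t0.
have [_ hd _] := WP_C1 hphi (ltW t0).
pose FF : set_system R := within [set h | 0 <= t + h] 0^'.
have hq : FF [set h | L2_on D (fun y => (slice v phi (t + h) y - slice v phi t y) / h)].
  apply: nearW => h th.
  apply: (@eq_L2_on _ _ (fun y => h^-1 * (slice v phi (t + h) y - slice v phi t y))) => //.
    by move=> y _; rewrite mulrC.
  by apply: L2_on_scale => //; apply: L2_on_sub => //; apply: L2_s => //; exact: ltW.
have hc := L2_cvg_pairing hq (L2_sD (ltW t0)) hk hd.
have hc' : h^-1 *: ((pairing phi k \o shift t) (h *: (1 : R)) - pairing phi k t) @[h --> 0^'] -->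
    pairing Dphi k t.
  move=> A /hc; rewrite /FF /within /= => hA.
  (* at t > 0 the one-sided restriction on h is void near 0 *)
  have near_pos : \forall h \near (0 : R)^', 0 <= t + h.
    apply: nbhs_dnbhs; exists t => // h; rewrite /ball_ /= sub0r normrN ltr_norml => /andP[]; lra.
  apply: filterS2 near_pos hA => h th; move=> /(_ th) /=.
  congr (A _); rewrite scaler1 [h + t]addrC.
  rewrite /pairing -RintegralB//; [|by apply: L2_on_mul_integrable => //; apply: L2_s => //; exact: ltW..].
  rewrite -[RHS]/(h^-1 * _) -RintegralZl//.
    by apply: eq_Rintegral_in => y _; ring.
  by apply: integrable_sub => //; apply: L2_on_mul_integrable => //; apply: L2_s => //; exact: ltW.
split; first by apply/cvg_ex; exists (pairing Dphi k t).
exact: cvg_lim hc'.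
Qed.

(** The time derivative of the pairing of phi_t with a profile whose derivative is k. *)
Definition flux k t : R := - (v * pairing phit k t + pairing phix k t).

Lemma continuous_flux k : L2_on D k -> continuous_nonneg (flux k).
Proof.
move=> hk; apply: (@continuous_nonneg_eq (fun t => - v * pairing phit k t + -1 * pairing phix k t)).
  by move=> t _; rewrite /flux; ring.
by apply: continuous_nonneg_add; apply: continuous_nonneg_scale;
  [exact: continuous_pairing_t|exact: continuous_pairing_x].
Qed.

(** The variational wave equation, tested with theta(t) k(x - v t).  The profile k is
free at the end y = 0, where the boundary condition is natural, and must vanish
at the Dirichlet end y = L. *)
Lemma time_derivative_pairing_t k k' : C1_deriv k k' -> k L = 0 ->
  time_derivative (pairing phit k) (flux k').
Proof.
move=> hk kL; have ck := C1_deriv_continuous hk; have [_ ck'] := hk.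
have hkL := continuous_L2_on_string ck; have hkL' := continuous_L2_on_string ck'.
apply: weak_time_derivative; [exact: continuous_pairing_t|exact: continuous_flux|].
move=> T T0 theta hC.
have [dth cth' [c [d [c0 cd dT thout]]]] := hC.
have hth := derive1_C1_deriv dth cth'; have cth := C1_deriv_continuous hth.
have [htest hpd] := test_fun_separated hC hth hk kL.
have := WP_wave hphi htest.
rewrite (@Rintegral_support _ _ `]0, T[); last 2 first.
- by apply: subset_itvl; rewrite bnd_simp.
- move=> t; rewrite /= !in_itv/= andbT => t0 tT.
  have tout : ~ (c <= t <= d).
    by move=> /andP[_ td]; apply: tT; rewrite t0/=; exact: le_lt_trans td dT.
  have dthout : derive1 theta t = 0.
    have td : d < t.
      by rewrite ltNge; apply/negP => td; apply: tT; rewrite t0/=; exact: le_lt_trans td dT.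
    rewrite derive1E; have : is_derive t (1 : R) theta 0.
      apply: (near_eq_is_derive _ (is_derive_cst (0 : R) t (1 : R))).
      near=> s; rewrite /cst thout// => /andP[_]; apply/negP; rewrite -ltNge.
      by near: s; exact: lt_nbhsr.
    by move=> h; exact: (@derive_val _ _ _ _ _ _ _ h).
  rewrite (eq_Rintegral_in (g := fun=> 0)) ?Rintegral_cst ?mul0r//.
    exact: measurable_itv.
  by move=> x _; have [-> ->] := hpd x t; rewrite dthout thout//; ring.
have inner t : `]0, T[%classic t ->
    \int[mu]_(x in I_ L v t) (phit x t * pdt (fun x t => theta t * k (x - v * t)) x t -
      phix x t * pdx (fun x t => theta t * k (x - v * t)) x t) =
    pairing phit k t * derive1 theta t + flux k' t * theta t.
  rewrite /= in_itv/= => /andP[t0 _].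
  have tt := ltW t0.
  have cshift f : continuous f -> continuous (fun x => f (x - v * t)).
    move=> cf x; apply: (@continuous_comp _ _ _ (fun x => x - v * t)); last exact: cf.
    by apply: cvgB; [exact: cvg_id|exact: cvg_cst].
  have i1 := integrable_mul_continuous (L2_phit tt) (cshift _ ck).
  have i2 := integrable_mul_continuous (L2_phit tt) (cshift _ ck').
  have i3 := integrable_mul_continuous (L2_phix tt) (cshift _ ck').
  rewrite /flux -!pairing_translate//; [|exact: L2_phix|exact: L2_phit..].
  transitivity (\int[mu]_(x in I_ L v t) (derive1 theta t * (phit x t * k (x - v * t)) +
     (- v * theta t * (phit x t * k' (x - v * t)) + - theta t * (phix x t * k' (x - v * t))))).
    by apply: eq_Rintegral_in => x _; have [-> ->] := hpd x t; ring.
  have s1 := integrable_scale (derive1 theta t) (measurable_itv _) i1.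
  have s2 := integrable_scale (- v * theta t) (measurable_itv _) i2.
  have s3 := integrable_scale (- theta t) (measurable_itv _) i3.
  have mI : measurable (I_ L v t) by exact: measurable_itv.
  rewrite RintegralD//; last exact: (integrable_add mI s2 s3).
  by rewrite RintegralD// !RintegralZl//; ring.
rewrite (eq_Rintegral_in inner) RintegralD//; last 2 first.
- apply: continuous_nonneg_integrable => //; exact: continuous_pairing_t.
- apply: continuous_nonneg_integrable => //; exact: continuous_flux.
by move=> /eqP; rewrite addr_eq0 => /eqP.
Unshelve. all: by end_near. Qed.

End String.

(** * Conservation of the amplitude of each mode *)

Lemma time_derivative_eq {R : realType} (w1 w1' w2 w2' : R -> R) :
  (forall t, 0 <= t -> w1 t = w2 t) -> (forall t, 0 <= t -> w1' t = w2' t) ->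
  time_derivative w1 w1' -> time_derivative w2 w2'.
Proof.
move=> e e' h T psi psi' T0 hpsi; rewrite -!e ?(ltW T0)// -(h T psi psi' T0 hpsi).
by congr (_ + _); apply: eq_Rintegral_in => t; rewrite /= in_itv/= => /andP[t0 _]; rewrite ?e ?e'// ltW.
Qed.

Section Modes.
Context {R : realType}.
Notation mu := (@lebesgue_measure R).
Variables (L v : R).
Hypothesis L0 : 0 < L.
Implicit Types (F : R -> R -> R) (f g h k psi theta : R -> R) (x e a b t : R).
Local Notation D := (`]0, L[)%classic.

Lemma C1_deriv_sin_scaled a : C1_deriv (fun y : R => sin (a * y)) (fun y => a * cos (a * y)).
Proof.
have := C1_deriv_affine a 0 (@C1_deriv_sin R).
by congr C1_deriv; apply/funext => y; rewrite /= /affine addr0.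
Qed.

Lemma C1_deriv_cos_scaled a : C1_deriv (fun y : R => cos (a * y)) (fun y => - a * sin (a * y)).
Proof.
have := C1_deriv_affine a 0 (@C1_deriv_cos R).
by congr C1_deriv; apply/funext => y; rewrite /= /affine addr0// mulrN mulNr.
Qed.

Lemma pairing_lin F f g a b t : L2_on D (slice v F t) -> continuous f -> continuous g ->
  pairing L v F (fun y => a * f y + b * g y) t =
  a * pairing L v F f t + b * pairing L v F g t.
Proof.
move=> hF cf cg; have i1 := integrable_mul_continuous hF cf.
have i2 := integrable_mul_continuous hF cg.
rewrite /pairing -!RintegralZl// -RintegralD//; [|exact: integrable_scale..].
by apply: eq_Rintegral_in => y _; ring.
Qed.

Variables (phi0 phi1 : R -> R) (phi phix phit : R -> R -> R).
Hypothesis hphi : WP_solution L v phi0 phi1 phi phix phit.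

Lemma H1_right_by_parts a b (w w' q q' : R -> R) : a < b -> H1_right a b w w' ->
  C1_deriv q q' -> q a = 0 ->
  \int[mu]_(x in `]a, b[) (w' x * q x) = - \int[mu]_(x in `]a, b[) (w x * q' x).
Proof.
move=> ab [[cw hw hw' wd] wb] hq qa.
have := weak_derivative_by_parts ab cw hw' wd hq.
by rewrite wb qa mul0r mulr0 subr0 addrC => /eqP; rewrite addr_eq0 => /eqP.
Qed.

(** No boundary term survives: phi vanishes at the right end and q at the left one. *)
Lemma pairing_by_parts q q' t : 0 <= t -> C1_deriv q q' -> q 0 = 0 ->
  pairing L v phix q t = - pairing L v phi q' t.
Proof.
move=> t0 hq q0.
have hpsi : C1_deriv (fun x => q (x - v * t)) (fun x => q' (x - v * t)).
  have := C1_deriv_affine 1 (- (v * t)) hq.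
  by congr C1_deriv; apply/funext => x; rewrite /affine /= ?mul1r.
have vtL : v * t < L + v * t by rewrite ltrDr.
have qa : q (v * t - v * t) = 0 by rewrite subrr.
have cq := C1_deriv_continuous hq; have [_ cq'] := hq.
rewrite -(pairing_translate (L2_phix hphi t0) cq) -(pairing_translate (L2_phi hphi t0) cq').
exact: (H1_right_by_parts vtL (WP_H1 hphi t0) hpsi qa).
Qed.

Variables (al be lam : R).
Hypothesis (alE : al * (1 + v) = lam) (beE : be * (1 - v) = lam).
Hypothesis (cosL : cos (al * L) = - cos (be * L)) (sinL : sin (al * L) = sin (be * L)).

Let ca (y : R) := cos (al * y). Let cb (y : R) := cos (be * y).
Let sa (y : R) := sin (al * y). Let sb (y : R) := sin (be * y).

(** The pairing of the solution with the real part of a standing mode; al and be are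
the wave numbers, in the frame of the string, of the two travelling waves whose
superposition is the mode. *)
Definition mode_re t : R :=
  \int[mu]_(y in D) (slice v phit t y * (cos (al * y) + cos (be * y)) +
                     slice v phix t y * (cos (al * y) - cos (be * y))).

Definition mode_im t : R :=
  \int[mu]_(y in D) (slice v phit t y * (sin (al * y) - sin (be * y)) +
                     slice v phix t y * (sin (al * y) + sin (be * y))).

Let C1ca : C1_deriv ca (fun y => - al * sa y). Proof. exact: C1_deriv_cos_scaled. Qed.
Let C1cb : C1_deriv cb (fun y => - be * sb y). Proof. exact: C1_deriv_cos_scaled. Qed.
Let C1sa : C1_deriv sa (fun y => al * ca y). Proof. exact: C1_deriv_sin_scaled. Qed.
Let C1sb : C1_deriv sb (fun y => be * cb y). Proof. exact: C1_deriv_sin_scaled. Qed.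

Let cca : continuous ca. Proof. exact: C1_deriv_continuous C1ca. Qed.
Let ccb : continuous cb. Proof. exact: C1_deriv_continuous C1cb. Qed.
Let csa : continuous sa. Proof. exact: C1_deriv_continuous C1sa. Qed.
Let csb : continuous sb. Proof. exact: C1_deriv_continuous C1sb. Qed.

Let lin (a b : R) (f g : R -> R) := fun y : R => a * f y + b * g y.

Let C1_lin a b f f' g g' : C1_deriv f f' -> C1_deriv g g' ->
  C1_deriv (lin a b f g) (lin a b f' g').
Proof. by move=> hf hg; apply: C1_deriv_add; apply: C1_deriv_scale. Qed.

Let L2_lin a b f g : continuous f -> continuous g -> L2_on D (lin a b f g).
Proof.
move=> cf cg; apply: continuous_L2_on_string => y; apply: cvgD; apply: cvgM;
  [exact: cvg_cst|exact: cf|exact: cvg_cst|exact: cg].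
Qed.

Let L2t t : 0 <= t -> L2_on D (slice v phit t).
Proof. by move=> t0; apply: L2_on_slice; exact: L2_phit hphi t t0. Qed.
Let L2x t : 0 <= t -> L2_on D (slice v phix t).
Proof. by move=> t0; apply: L2_on_slice; exact: L2_phix hphi t t0. Qed.

Let mode_pairing a b a' b' f g t : 0 <= t -> continuous f -> continuous g ->
  \int[mu]_(y in D) (slice v phit t y * lin a b f g y + slice v phix t y * lin a' b' f g y) =
  a * pairing L v phit f t + b * pairing L v phit g t +
  (a' * pairing L v phix f t + b' * pairing L v phix g t).
Proof.
move=> t0 cf cg; have hl u w := L2_lin u w cf cg.
rewrite RintegralD//; [|exact: L2_on_mul_integrable (L2t t0) (hl _ _)
  |exact: L2_on_mul_integrable (L2x t0) (hl _ _)].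
by rewrite -!pairing_lin//; [exact: L2x|exact: L2t].
Qed.

Let mode_reE t : 0 <= t -> mode_re t =
  1 * pairing L v phit ca t + 1 * pairing L v phit cb t +
  (1 * pairing L v phix ca t + -1 * pairing L v phix cb t).
Proof.
move=> t0; rewrite -mode_pairing//; apply: eq_Rintegral_in => y _.
by rewrite /lin /ca /cb; ring.
Qed.

Let mode_imE t : 0 <= t -> mode_im t =
  1 * pairing L v phit sa t + -1 * pairing L v phit sb t +
  (1 * pairing L v phix sa t + 1 * pairing L v phix sb t).
Proof.
move=> t0; rewrite -mode_pairing//; apply: eq_Rintegral_in => y _.
by rewrite /lin /sa /sb; ring.
Qed.

(** The term with phi_x is rewritten with phi by parts before it is differentiated in
time; f and g are the two waves, with weights (a, b) against phi_t and (a', b')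
against phi_x. *)
Let mode_derivative a b a' b' f f' g g' (Z W : R -> R) :
  C1_deriv f f' -> C1_deriv g g' -> lin a b f g L = 0 -> lin a' b' f g 0 = 0 ->
  (forall t, 0 <= t -> Z t = a * pairing L v phit f t + b * pairing L v phit g t +
    (a' * pairing L v phix f t + b' * pairing L v phix g t)) ->
  (forall t, 0 <= t -> W t = flux L v phix phit (lin a b f' g') t -
     (pairing L v phit (lin a' b' f' g') t + v * pairing L v phix (lin a' b' f' g') t)) ->
  [/\ continuous_nonneg Z & time_derivative Z W].
Proof.
move=> hf hg kL q0 ZE WE.
have cf := C1_deriv_continuous hf; have cg := C1_deriv_continuous hg.
have [_ cf'] := hf; have [_ cg'] := hg.
have hk := C1_lin a b hf hg; have hq := C1_lin a' b' hf hg.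
have L2k := L2_lin a b cf cg; have L2q' := L2_lin a' b' cf' cg'; have L2k' := L2_lin a b cf' cg'.
(* Z is Z' after an integration by parts, and Z' can be differentiated in time *)
pose Z' t := pairing L v phit (lin a b f g) t + - pairing L v phi (lin a' b' f' g') t.
pose Dphi x t := phit x t + v * phix x t.
have ZZ' t : 0 <= t -> Z' t = Z t.
  move=> t0; rewrite ZE// /Z' -(pairing_by_parts t0 hq q0).
  by rewrite !pairing_lin//; [exact: L2x|exact: L2t].
have cP := continuous_nonneg_scale (c := -1) (continuous_pairing hphi L2q').
have cPD := continuous_nonneg_scale (c := -1) (continuous_pairing_material hphi L2q').
have cneg (F : R -> R -> R) : continuous_nonneg (fun t => -1 * pairing L v F (lin a' b' f' g') t) ->
    continuous_nonneg (fun t => - pairing L v F (lin a' b' f' g') t).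
  by apply: continuous_nonneg_eq => t _; rewrite mulN1r.
have ct := continuous_pairing_t hphi L2k.
have cfl := continuous_flux hphi L2k'.
split.
  apply: (continuous_nonneg_eq ZZ'); apply: continuous_nonneg_add => //.
  exact: cneg cP.
have dneg : time_derivative (fun t => - pairing L v phi (lin a' b' f' g') t)
    (fun t => - pairing L v Dphi (lin a' b' f' g') t).
  apply: is_derive_time_derivative; [exact: cneg cP|exact: cneg cPD|].
  by move=> t t0; apply: is_deriveN; exact: (is_derive_pairing hphi L2q' t0).
have := time_derivative_add ct cfl (cneg _ cP) (cneg _ cPD) (time_derivative_pairing_t hphi hk kL) dneg.
apply: time_derivative_eq ZZ' _ => t t0.
by rewrite WE// -(pairing_material hphi L2q' t0).
Qed.

(** With alE and beE both waves turn at the same angular speed lam in the frame of the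
string.  The conditions cosL and sinL make the profiles against phi_t vanish at
y = L; those against phi_x vanish at y = 0 by themselves. *)
Lemma mode_conserved t : 0 <= t ->
  mode_re t ^+ 2 + mode_im t ^+ 2 = mode_re 0 ^+ 2 + mode_im 0 ^+ 2.
Proof.
have scaleE F f c t' : 0 <= t' -> L2_on D (slice v F t') -> continuous f ->
    pairing L v F (fun y => c * f y) t' = c * pairing L v F f t'.
  move=> t'0 hF cf; rewrite /pairing -RintegralZl//; last exact: integrable_mul_continuous.
  by apply: eq_Rintegral_in => y _; ring.
have ccZ c f : continuous f -> continuous (fun y : R => c * f y).
  by move=> cf y; apply: cvgM; [exact: cvg_cst|exact: cf].
have [cR dR] : [/\ continuous_nonneg mode_re & time_derivative mode_re (fun t => lam * mode_im t)].
  apply: (@mode_derivative 1 1 1 (-1) ca _ cb _ _ _ C1ca C1cb _ _ mode_reE).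
  - by rewrite /lin /ca /cb cosL; ring.
  - by rewrite /lin /ca /cb !mulr0; ring.
  - move=> t' t'0; rewrite mode_imE// /flux !pairing_lin//; try (exact: L2t); try (exact: L2x);
      try (exact: ccZ).
    rewrite !scaleE//; try (exact: L2t); try (exact: L2x).
    transitivity (al * (1 + v) * pairing L v phit sa t' - be * (1 - v) * pairing L v phit sb t' +
      (al * (1 + v) * pairing L v phix sa t' + be * (1 - v) * pairing L v phix sb t')).
      by rewrite alE beE; ring.
    by ring.
have [cI dI] : [/\ continuous_nonneg mode_im & time_derivative mode_im (fun t => - lam * mode_re t)].
  apply: (@mode_derivative 1 (-1) 1 1 sa _ sb _ _ _ C1sa C1sb _ _ mode_imE).
  - by rewrite /lin /sa /sb sinL; ring.
  - by rewrite /lin /sa /sb !mulr0 sin0; ring.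
  - move=> t' t'0; rewrite mode_reE// /flux !pairing_lin//; try (exact: L2t); try (exact: L2x);
      try (exact: ccZ).
    rewrite !scaleE//; try (exact: L2t); try (exact: L2x).
    transitivity (- (al * (1 + v)) * pairing L v phit ca t' - be * (1 - v) * pairing L v phit cb t' -
      (al * (1 + v) * pairing L v phix ca t' - be * (1 - v) * pairing L v phix cb t')).
      by rewrite alE beE; ring.
    by ring.
by apply: (rotation_conserved cR cI dR dI).
Qed.

End Modes.

(** * Unfolding the two travelling components *)

Section Unfolding.
Context {R : realType}.
Notation mu := (@lebesgue_measure R).
Implicit Types (f g h p q : R -> R) (x a b c t : R).

(** The point b carries no mass, so the two open pieces decide. *)
Lemma L2_on_glue a b c f : a < b -> b < c ->
  L2_on `]a, b[ f -> L2_on `]b, c[ f -> L2_on `]a, c[ f.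
Proof.
move=> ab bc [mf1 i1] [mf2 i2].
have mf2' : measurable_fun `[b, c[ f.
  rewrite -(@setU1itv _ _ _ _ false) ?bnd_simp//; apply/measurable_funU => //.
  by split => //; exact: measurable_fun_set1.
have split_itv : `]a, c[%classic = `]a, b[%classic `|` `[b, c[%classic.
  rewrite -itv_bndbnd_setU ?bnd_simp//. exact: ltW.
have mf : measurable_fun `]a, c[ f by rewrite split_itv; apply/measurable_funU.
split => //; apply/integrableP; split.
  by apply/measurable_EFinP; exact: measurable_funX.
have mEf D : measurable_fun D f -> measurable_fun D (fun x => `|(f x ^+ 2)%:E|%E).
  by move=> mfD; apply: measurableT_comp => //; apply/measurable_EFinP; exact: measurable_funX.
rewrite split_itv ge0_integral_setU//; last 2 first.
- by rewrite -split_itv; exact: mEf.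
- apply/disj_setPS => y [/=]; rewrite !in_itv/= => /andP[_ yb] /andP[].
  by rewrite leNgt yb.
rewrite -integral_itv_obnd_cbnd; last exact: mEf.
apply: lte_add_pinfty; first by case/integrableP : i1.
by case/integrableP : i2.
Qed.

Variables (L v : R).
Hypothesis L0 : 0 < L.
Hypothesis v01 : 0 <= v < 1.
Local Notation D := (`]0, L[)%classic.
Local Notation P := (L_2 L v).
Local Notation gam := (gamma_ v).

Let v0 : 0 <= v. Proof. by case/andP: v01. Qed.
Let v1 : v < 1. Proof. by case/andP: v01. Qed.
Let w1 : 0 < 1 - v. Proof. by rewrite subr_gt0. Qed.
Let w2 : 0 < 1 + v. Proof. by rewrite ltr_pwDl. Qed.
Let gam0 : 0 < gam. Proof. by rewrite divr_gt0. Qed.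
Let nz1 : 1 - v != 0. Proof. by rewrite gt_eqF. Qed.
Let nz2 : 1 + v != 0. Proof. by rewrite gt_eqF. Qed.

Lemma L_2_gt0 : 0 < P. Proof. by rewrite /L_2 divr_gt0// mulr_gt0. Qed.

Lemma L_lt_L_2 : L < P.
Proof.
by rewrite /L_2 ltr_pdivlMr// mulrBr mulr1; have := mulr_ge0 (ltW L0) v0; move: (L0); lra.
Qed.

(** The affine map of ]L, L_2[ onto ]0, L[ that appears in the extension of the
initial data. *)
Definition fold_back (x : R) : R := affine (- gam^-1) (2 * L / (1 + v)) x.

Lemma fold_slope_neq0 : - gam^-1 != 0. Proof. by rewrite oppr_eq0 invr_eq0 gt_eqF. Qed.

Lemma preimage_fold : fold_back @^-1` D = `]L, P[%classic.
Proof.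
rewrite /fold_back affine_preimage_itvoo_neg ?oppr_lt0 ?invr_gt0//.
rewrite (_ : (L - 2 * L / (1 + v)) / - gam^-1 = L); last first.
  by rewrite /gamma_; field; rewrite nz1 nz2.
rewrite (_ : (0 - 2 * L / (1 + v)) / - gam^-1 = P)//.
by rewrite /L_2 /gamma_; field; rewrite nz1 nz2.
Qed.

Lemma unfoldK x : x = P - gam * fold_back x.
Proof. by rewrite /fold_back /affine /L_2 /gamma_; field; rewrite nz1 nz2. Qed.

(** The values p are followed by the reflected and stretched values of q; this is the
shape of the extension of the initial data. *)
Definition unfolded p q (x : R) : R := if x < L then p x else - gam^-1 * q (fold_back x).

Lemma L2_on_unfold p q : L2_on D p -> L2_on D q -> L2_on `]0, P[ (unfolded p q).
Proof.
move=> hp hq; apply: (L2_on_glue L0 L_lt_L_2).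
  apply: eq_L2_on hp => // x; rewrite /= in_itv/= => /andP[_ xL].
  by rewrite /unfolded xL.
have mD : measurable D by exact: measurable_itv.
have := L2_on_affine (2 * L / (1 + v)) fold_slope_neq0 mD hq.
rewrite -/fold_back preimage_fold => h2.
apply: eq_L2_on (L2_on_scale (- gam^-1) (measurable_itv _) h2) => // x.
by rewrite /= in_itv/= => /andP[Lx _]; rewrite /unfolded ltNge (ltW Lx).
Qed.

Lemma integral_fold h : mu.-integrable D (EFin \o h) ->
  \int[mu]_(x in `]L, P[) h (fold_back x) = gam * \int[mu]_(y in D) h y.
Proof.
move=> hi; rewrite (Rintegral_affine (2 * L / (1 + v)) fold_slope_neq0 _ hi)//.
rewrite -/fold_back preimage_fold normrN gtr0_norm ?invr_gt0// mulrA mulfV ?mul1r// gt_eqF//.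
Qed.

Lemma integral_sqr_unfold p q : L2_on D p -> L2_on D q ->
  \int[mu]_(x in `]0, P[) (unfolded p q x ^+ 2) =
  \int[mu]_(y in D) (p y ^+ 2) + gam^-1 * \int[mu]_(y in D) (q y ^+ 2).
Proof.
move=> hp hq; have [_ iu] := L2_on_unfold hp hq.
rewrite (Rintegral_split (ltW L0) (ltW L_lt_L_2) iu); congr (_ + _).
  by apply: eq_Rintegral_in => x; rewrite /= in_itv/= /unfolded => /andP[_ ->].
have iq := integrable_scale (gam^-1 ^+ 2) (measurable_itv _) hq.2.
transitivity (\int[mu]_(x in `]L, P[) (gam^-1 ^+ 2 * q (fold_back x) ^+ 2)).
  apply: eq_Rintegral_in => x; rewrite /= in_itv/= /unfolded => /andP[Lx _].
  by rewrite ltNge (ltW Lx) /= exprMn sqrrN.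
rewrite (integral_fold iq) RintegralZl//; last exact: hq.2.
by rewrite mulrA; congr (_ * _); rewrite expr2 mulrA mulfV ?mul1r// gt_eqF.
Qed.

Lemma integral_unfold_mul p q K K' : L2_on D p -> L2_on D q ->
  continuous K -> continuous K' -> (forall y, K (P - gam * y) = K' y) ->
  \int[mu]_(x in `]0, P[) (unfolded p q x * K x) =
  \int[mu]_(y in D) (p y * K y - q y * K' y).
Proof.
move=> hp hq cK cK' KK'.
have ip := integrable_mul_continuous hp cK; have iq := integrable_mul_continuous hq cK'.
rewrite RintegralB//.
rewrite (Rintegral_split (ltW L0) (ltW L_lt_L_2) (integrable_mul_continuous (L2_on_unfold hp hq) cK)).
congr (_ + _).
  by apply: eq_Rintegral_in => x; rewrite /= in_itv/= /unfolded => /andP[_ ->].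
have iq' := integrable_scale (- gam^-1) (measurable_itv _) iq.
transitivity (\int[mu]_(x in `]L, P[) (- gam^-1 * (q (fold_back x) * K' (fold_back x)))).
  apply: eq_Rintegral_in => x; rewrite /= in_itv/= /unfolded => /andP[Lx _].
  by rewrite ltNge (ltW Lx) /= [in K x](unfoldK x) KK' mulrA.
rewrite (integral_fold iq') RintegralZl// mulrA mulrN mulfV ?mulN1r// gt_eqF//.
Qed.

Lemma freq_L2 n : freq P n * P = n.*2.+1%:R * pi.
Proof. by rewrite /freq divfK// gt_eqF// L_2_gt0. Qed.

Lemma odd_pi_cos n (z : R) : cos (n.*2.+1%:R * pi - z) = - cos z.
Proof.
have -> : n.*2.+1%:R * pi - z = (pi - z) + (pi *+ 2) *+ n :> R.
  by rewrite -mulrnA -mulr_natr -mul2n -addn1 natrD; ring.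
rewrite (periodicn (@cosD2pi R)) -[LHS]cosN opprB.
by rewrite -[LHS]opprK -cosDpi subrK.
Qed.

Lemma odd_pi_sin n (z : R) : sin (n.*2.+1%:R * pi - z) = sin z.
Proof.
have -> : n.*2.+1%:R * pi - z = (pi - z) + (pi *+ 2) *+ n :> R.
  by rewrite -mulrnA -mulr_natr -mul2n -addn1 natrD; ring.
rewrite (periodicn (@sinD2pi R)) -[LHS]opprK -sinN opprB.
by rewrite -sinDpi subrK.
Qed.

Local Notation be n := (freq P n * gam).

(** Translation by L_2 changes the sign of the cosine, since freq * L_2 is an odd
multiple of pi. *)
Lemma cos_freq_unfold n y : cos (freq P n * (P - gam * y)) = - cos (be n * y).
Proof. by rewrite mulrBr freq_L2 odd_pi_cos mulrA. Qed.

Lemma sin_freq_unfold n y : sin (freq P n * (P - gam * y)) = sin (be n * y).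
Proof. by rewrite mulrBr freq_L2 odd_pi_sin mulrA. Qed.

Lemma freq_L n : freq P n * L = n.*2.+1%:R * pi - be n * L.
Proof. by rewrite -freq_L2 /L_2 /gamma_; field. Qed.

Definition unfolded_pair f g := unfolded (fun y => f y + g y) (fun y => f y - g y).

Lemma integral_unfold_cos n f g : L2_on D f -> L2_on D g ->
  \int[mu]_(x in `]0, P[) (unfolded_pair f g x * cos (freq P n * x)) =
  \int[mu]_(y in D) (f y * (cos (freq P n * y) + cos (be n * y)) +
                     g y * (cos (freq P n * y) - cos (be n * y))).
Proof.
move=> hf hg.
rewrite (@integral_unfold_mul _ _ _ (fun y => - cos (be n * y))).
- by apply: eq_Rintegral_in => y _; ring.
- exact: L2_on_add.
- exact: L2_on_sub.
- exact: C1_deriv_continuous (C1_deriv_cos_scaled _).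
- by move=> y; apply: cvgN; exact: C1_deriv_continuous (C1_deriv_cos_scaled _) y.
- by move=> y; exact: cos_freq_unfold.
Qed.

Lemma integral_unfold_sin n f g : L2_on D f -> L2_on D g ->
  \int[mu]_(x in `]0, P[) (unfolded_pair f g x * sin (freq P n * x)) =
  \int[mu]_(y in D) (f y * (sin (freq P n * y) - sin (be n * y)) +
                     g y * (sin (freq P n * y) + sin (be n * y))).
Proof.
move=> hf hg.
rewrite (@integral_unfold_mul _ _ _ (fun y => sin (be n * y))).
- by apply: eq_Rintegral_in => y _; ring.
- exact: L2_on_add.
- exact: L2_on_sub.
- exact: C1_deriv_continuous (C1_deriv_sin_scaled _).
- exact: C1_deriv_continuous (C1_deriv_sin_scaled _).
- by move=> y; exact: sin_freq_unfold.
Qed.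

(** In terms of p = f + g and q = f - g the energy density is
((1 + v) p^2 + (1 - v) q^2) / 4, and stretching by gamma_v accounts for the
ratio (1 - v) / (1 + v) of the two weights. *)
Lemma energy_unfold f g : L2_on D f -> L2_on D g ->
  2^-1 * \int[mu]_(y in D) ((f y + v * g y) ^+ 2 + (1 - v ^+ 2) * g y ^+ 2) =
  (1 + v) / 4 * \int[mu]_(x in `]0, P[) (unfolded_pair f g x ^+ 2).
Proof.
move=> hf hg.
have [_ ip] := L2_on_add (measurable_itv _) hf hg.
have [_ iq] := L2_on_sub (measurable_itv _) hf hg.
rewrite integral_sqr_unfold; [|exact: L2_on_add|exact: L2_on_sub].
rewrite -(RintegralZl gam^-1)// -RintegralD//; last exact: integrable_scale.
have i1 := integrable_add (measurable_itv _) ip (integrable_scale gam^-1 (measurable_itv _) iq).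
transitivity ((1 + v) / 4 * (\int[mu]_(y in D) (2 / (1 + v) * ((f y + v * g y) ^+ 2 + (1 - v ^+ 2) * g y ^+ 2)))).
  rewrite RintegralZl//; first by field.
  apply: (eq_integrable_EFin _ _ (integrable_scale ((1 + v) / 2) (measurable_itv _) i1)) => // x _.
  by rewrite /gamma_; field; rewrite nz1.
congr (_ * _); apply: eq_Rintegral_in => y _; rewrite /gamma_; field; rewrite ?nz1//.
Qed.

End Unfolding.

(** * Fourier coefficients and energy *)

Section Coefficients.
Context {R : realType}.
Notation mu := (@lebesgue_measure R).
Local Open Scope complex_scope.
Implicit Types (L v x : R) (m : nat) (n : int).

Lemma complex_natr m : (m%:R : R[i]) = (m%:R : R)%:C.
Proof. by rewrite rmorph_nat. Qed.

Lemma complex_intr n : (n%:~R : R[i]) = (n%:~R : R)%:C.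
Proof. by rewrite rmorph_int. Qed.

Lemma complex_invr x : (x%:C)^-1 = (x^-1)%:C.
Proof. by rewrite fmorphV. Qed.

Lemma omegaE n : omega R n = 0 +i* ((2 * n + 1)%:~R * pi / 2).
Proof. by rewrite /omega complex_natr complex_intr complex_invr; simpc. Qed.

Lemma cexp_imaginary x : cexp (0 +i* x) = cos x +i* sin x.
Proof. by rewrite /cexp /= expR0; simpc. Qed.

Lemma odd_int_neq0 n : (2 * n + 1)%:~R != 0 :> R.
Proof. by rewrite intr_eq0; lia. Qed.

(** The factor 2 n + 1 cancels against omega_n, which leaves the modulus of the
Fourier integral divided by 2 pi. *)
Lemma normc_coef_sqr L v (f g : R -> R) n (kap A B : R) :
  0 < L -> v < 1 -> kap = (2 * n + 1)%:~R * pi / L_2 L v ->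
  A = \int[mu]_(x in `]0, L_2 L v[) ((ext_dphi0 L v f x + ext_phi1 L v g x) * cos (kap * x)) ->
  B = \int[mu]_(x in `]0, L_2 L v[) - ((ext_dphi0 L v f x + ext_phi1 L v g x) * sin (kap * x)) ->
  Normc.normc ((2 * n + 1)%:~R * coef L v f g n) ^+ 2 =
  (A ^+ 2 + B ^+ 2) / (4 * pi ^+ 2).
Proof.
move=> L0 v1 kapE AE BE.
have v10 : 1 - v != 0 by rewrite gt_eqF// subr_gt0.
have L00 : L != 0 by rewrite gt_eqF.
have argE x : - ((1 - v) / L)%:C * omega R n * x%:C = 0 +i* - (kap * x).
  rewrite omegaE; simpc; congr (0 +i* - (_ * _)); rewrite kapE /L_2; field.
  by rewrite v10 L00.
have CE : Cintegral `]0, L_2 L v[ (fun x =>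
    (ext_dphi0 L v f x + ext_phi1 L v g x)%:C *
    cexp (- ((1 - v) / L)%:C * omega R n * x%:C)) = A +i* B.
  rewrite /Cintegral AE BE; congr (_ +i* _); apply: eq_Rintegral_in => x _;
    rewrite argE cexp_imaginary cosN sinN; simpc => //=.
rewrite /coef CE.
set r : R := (2 * n + 1)%:~R.
have r0 : r != 0 by exact: odd_int_neq0.
have pi0 : pi != 0 :> R by rewrite gt_eqF// pi_gt0.
have -> : (4 * omega R n)^-1 = 0 +i* - (2 * r * pi)^-1.
  rewrite omegaE -/r; move: r r0 (pi : R) pi0 => {}r r0 p p0.
  apply: mulr1_eq; rewrite complex_natr; simpc.
  by congr (_ +i* 0); field; rewrite p0 r0.
rewrite complex_intr -/r; simpc.
rewrite /Normc.normc sqr_sqrtr; last by rewrite addr_ge0// sqr_ge0.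
move: r r0 (pi : R) pi0 => {}r r0 p p0.
by field; rewrite p0 r0.
Qed.

End Coefficients.

Section IntegerSums.
Context {R : realType}.

Lemma esum_nat_cvg (c : nat -> R) (S : R) : (forall m, 0 <= c m) ->
  \sum_(m < N) c m @[N --> \oo] --> S ->
  (\esum_(m in [set: nat]) (c m)%:E = S%:E)%E.
Proof.
move=> c0 cS; rewrite -nneseries_esumT; last by move=> m; rewrite lee_fin.
apply/cvg_lim => //; apply/fine_cvgP; split.
  by apply: nearW => N; rewrite sumEFin.
by under eq_fun do rewrite /= sumEFin big_mkord /=.
Qed.

Lemma esum_int_nat (F : int -> R) (c : nat -> R) : (forall m, 0 <= c m) ->
  (forall m, F (Posz m) = c m) -> (forall m, F (Negz m) = c m) ->
  (\esum_(n in [set: int]) (F n)%:E =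
   \esum_(m in [set: nat]) (c m)%:E + \esum_(m in [set: nat]) (c m)%:E)%E.
Proof.
move=> c0 FP FN.
have F0 n : 0 <= F n by case: n => m; rewrite ?FP ?FN.
rewrite (esumID [set n : int | 0 <= n]); last by move=> n _; rewrite lee_fin.
rewrite !setTI; congr (_ + _)%E.
  rewrite (reindex_esum [set: nat] _ Posz); first by apply: eq_esum => m _; rewrite FP.
  split; [by []|by move=> m n _ _ []|by move=> [m|m] //= _; exists m].
rewrite (reindex_esum [set: nat] _ Negz); first by apply: eq_esum => m _; rewrite FN.
split; [by []|by move=> m n _ _ []|].
by move=> [m|m] //= h; exists m.
Qed.

End IntegerSums.

Section Energy.
Context {R : realType}.
Notation mu := (@lebesgue_measure R).
Variables (L v : R).
Hypothesis L0 : 0 < L.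
Hypothesis v01 : 0 <= v < 1.
Local Notation D := (`]0, L[)%classic.
Local Notation P := (L_2 L v).
Implicit Types (f g : R -> R) (t : R).

Definition fourier_sqr (h : R -> R) (n : nat) : R :=
  (\int[mu]_(x in `]0, P[) (h x * cos (freq P n * x))) ^+ 2 +
  (\int[mu]_(x in `]0, P[) (h x * sin (freq P n * x))) ^+ 2.

Lemma ext_unfold f g x : ext_dphi0 L v f x + ext_phi1 L v g x = unfolded_pair L v g f x.
Proof.
rewrite /ext_dphi0 /ext_phi1 /unfolded_pair /unfolded; case: ifP => _; first by rewrite addrC.
have -> : - x / gamma_ v + 2 * L / (1 + v) = fold_back L v x.
  by rewrite /fold_back /affine; congr (_ + _); rewrite mulNr mulNr mulrC.
ring.
Qed.

(** The indices m and - m - 1 carry opposite frequencies, hence conjugate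
coefficients of the real extension. *)
Lemma coef_fourier_sqr f g (n : int) (m : nat) : L2_on D f -> L2_on D g ->
  n = Posz m \/ n = Negz m ->
  Normc.normc ((2 * n + 1)%:~R * coef L v f g n) ^+ 2 =
  fourier_sqr (unfolded_pair L v g f) m / (4 * pi ^+ 2).
Proof.
move=> hf hg nm; have [v0 v1] := andP v01.
pose s : R := if n is Posz _ then 1 else -1.
have s2 : s ^+ 2 = 1 by rewrite /s; case: (n) => ?; rewrite ?sqrrN expr1n.
have kE : (2 * n + 1)%:~R * pi / P = s * freq P m.
  rewrite /freq /s; case: nm => ->.
    by rewrite (_ : 2 * Posz m + 1 = Posz m.*2.+1); [rewrite mul1r -pmulrn|lia].
  by rewrite (_ : 2 * Negz m + 1 = - Posz m.*2.+1); [rewrite mulrNz -pmulrn mulN1r !mulNr|lia].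
rewrite (normc_coef_sqr L0 v1 (esym kE) erefl erefl); congr (_ / _).
rewrite /fourier_sqr; congr (_ + _).
  congr (_ ^+ 2); apply: eq_Rintegral_in => x _; rewrite ext_unfold; congr (_ * _).
  by rewrite /s; case: (n) => ?; rewrite ?mul1r// mulN1r mulNr cosN.
have sinE x : sin (s * freq P m * x) = s * sin (freq P m * x).
  by rewrite /s; case: (n) => ?; rewrite ?mul1r// !mulN1r mulNr sinN.
rewrite -[RHS]mul1r -s2 -[s ^+ 2]sqrrN -exprMn -RintegralZl//.
  by congr (_ ^+ 2); apply: eq_Rintegral_in => x _; rewrite ext_unfold sinE; ring.
apply: integrable_mul_continuous; last exact: C1_deriv_continuous (C1_deriv_sin_scaled _).
by apply: L2_on_unfold => //; [exact: L2_on_add|exact: L2_on_sub].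
Qed.

Lemma fourier_sqr_ge0 h m : 0 <= fourier_sqr h m.
Proof. by rewrite addr_ge0// sqr_ge0. Qed.

Lemma esum_coef f g : L2_on D f -> L2_on D g ->
  (((pi ^+ 2 * (1 - v ^+ 2) / (2 * L))%:E *
    \esum_(n in [set: int])
      (Normc.normc ((2 * n + 1)%:~R * coef L v f g n) ^+ 2)%:E) =
   ((1 + v) / 4 * \int[mu]_(x in `]0, P[) (unfolded_pair L v g f x ^+ 2))%:E)%E.
Proof.
move=> hf hg; have [v0 v1] := andP v01.
have P0 := L_2_gt0 L0 v01.
have hu : L2_on `]0, P[ (unfolded_pair L v g f).
  by apply: L2_on_unfold => //; [exact: L2_on_add|exact: L2_on_sub].
pose S := \int[mu]_(x in `]0, P[) (unfolded_pair L v g f x ^+ 2).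
pose c m := fourier_sqr (unfolded_pair L v g f) m / (4 * pi ^+ 2).
have pi0 : 0 < pi :> R by exact: pi_gt0.
have c0 m : 0 <= c m by rewrite divr_ge0 ?fourier_sqr_ge0// mulr_ge0// sqr_ge0.
have hc : \sum_(m < N) c m @[N --> \oo] --> P / 2 / (4 * pi ^+ 2) * S.
  have cE N : \sum_(m < N) c m = P / 2 / (4 * pi ^+ 2) *
      (2 / P * \sum_(n < N) fourier_sqr (unfolded_pair L v g f) n).
    rewrite /c -mulr_suml; move: (\sum_(n < N) _) P0 => s.
    by move: (L_2 L v) (pi : R) pi0 => p q q0 p0; field; rewrite !gt_eqF.
  rewrite (funext cE); apply: (cvgM (cvg_cst _)); exact: trig_parseval P0 hu.
rewrite (@esum_int_nat _ _ c)//; last 2 first.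
- by move=> m; apply: coef_fourier_sqr => //; left.
- by move=> m; apply: coef_fourier_sqr => //; right.
rewrite (esum_nat_cvg c0 hc) -EFinD -EFinM; congr EFin; rewrite -/S /L_2.
have nv : 1 - v != 0 by rewrite subr_eq0 gt_eqF.
have nL : L != 0 by rewrite gt_eqF.
by move: (pi : R) pi0 => p p0; field; rewrite nv nL gt_eqF.
Qed.

Lemma energy_unfold_pair phix phit t :
  L2_on (I_ L v t) (phit^~ t) -> L2_on (I_ L v t) (phix^~ t) ->
  energy L v phix phit t =
  ((1 + v) / 4 * \int[mu]_(x in `]0, P[)
     (unfolded_pair L v (slice v phit t) (slice v phix t) x ^+ 2))%:E.
Proof.
move=> ht hx; have [v0 v1] := andP v01.
have v20 : 0 <= 1 - v ^+ 2.
  by rewrite subr_ge0 -[leRHS](expr1n _ 2) lerXn2r ?nnegrE// ltW.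
have ht' := L2_on_slice ht; have hx' := L2_on_slice hx.
rewrite -(energy_unfold L0 v01 ht' hx') /energy EFinM; congr (_ * _)%E.
have mI : measurable (I_ L v t) by exact: measurable_itv.
have h0 y : (0 <= ((phit y t + v * phix y t) ^+ 2 + (1 - v ^+ 2) * phix y t ^+ 2)%:E)%E.
  by rewrite lee_fin addr_ge0 ?sqr_ge0// mulr_ge0 ?sqr_ge0.
have mh : measurable_fun (I_ L v t)
    (fun y => ((phit y t + v * phix y t) ^+ 2 + (1 - v ^+ 2) * phix y t ^+ 2)%:E).
  apply/measurable_EFinP; apply: measurable_funD.
    by apply: measurable_funX; apply: measurable_funD; [exact: ht.1|apply: measurable_funM => //; exact: hx.1].
  by apply: measurable_funM => //; apply: measurable_funX; exact: hx.1.
rewrite (ge0_integral_affine (v * t) (oner_neq0 R) mI mh (fun y _ => h0 y)).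
rewrite normr1 mul1e preimage_I_ /Rintegral fineK.
  by apply: eq_integral => y _; rewrite /slice /affine mul1r.
have mD : measurable D by exact: measurable_itv.
have [_ i1] := L2_on_add mD ht' (L2_on_scale v mD hx').
have := integrable_add mD i1 (integrable_scale (1 - v ^+ 2) mD hx'.2).
exact: integrable_fin_num.
Qed.

End Energy.

Section Conservation.
Context {R : realType}.
Notation mu := (@lebesgue_measure R).
Variables (L v : R).
Hypothesis L0 : 0 < L.
Hypothesis v01 : 0 <= v < 1.
Variables (phi0 dphi0 phi1 : R -> R) (phi phix phit : R -> R -> R).
Hypothesis hphi0 : H1_right 0 L phi0 dphi0.
Hypothesis hphi1 : L2_on `]0, L[ phi1.
Hypothesis hphi : WP_solution L v phi0 phi1 phi phix phit.
Local Notation D := (`]0, L[)%classic.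
Local Notation P := (L_2 L v).

Let hdphi0 : L2_on D dphi0. Proof. by case: hphi0 => -[]. Qed.
Let L2t t : 0 <= t -> L2_on D (slice v phit t).
Proof. by move=> t0; apply: L2_on_slice; exact: L2_phit hphi t t0. Qed.
Let L2x t : 0 <= t -> L2_on D (slice v phix t).
Proof. by move=> t0; apply: L2_on_slice; exact: L2_phix hphi t t0. Qed.

(** The initial condition for phi_t holds almost everywhere.  That for phi concerns
values, so the weak derivatives phi_x and dphi0 are compared by parts. *)
Lemma initial_pairing k q q' : continuous k -> C1_deriv q q' -> q 0 = 0 ->
  \int[mu]_(y in D) (slice v phit 0 y * k y + slice v phix 0 y * q y) =
  \int[mu]_(y in D) (phi1 y * k y + dphi0 y * q y).
Proof.
move=> ck hq q0; have cq := C1_deriv_continuous hq.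
rewrite !RintegralD//; try exact: integrable_mul_continuous;
  try (apply: integrable_mul_continuous => //; [exact: L2t|exact: L2x]).
2-3: by apply: integrable_mul_continuous => //; by [exact: L2t|exact: L2x].
congr (_ + _).
  rewrite /Rintegral; congr fine; apply: ae_eq_integral => //.
  - by apply/measurable_EFinP; apply: measurable_funM;
      [case: (L2t (lexx 0))|case: (continuous_L2_on_string L ck)].
  - by apply/measurable_EFinP; apply: measurable_funM;
      [case: hphi1|case: (continuous_L2_on_string L ck)].
  - have [N [mN N0 subN]] := WP_init1 hphi; exists N; split => //.
    apply: subset_trans subN => y /= hy h; apply: hy => yD.
    have e : phit y 0 = phi1 y by apply: h; rewrite /I_ mulr0 addr0.
    by rewrite /slice mulr0 addr0 e.
have := pairing_by_parts L0 hphi (lexx 0) hq q0; rewrite /pairing => ->.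
rewrite (H1_right_by_parts L0 hphi0 hq q0); congr (- _).
apply: eq_Rintegral_in => y yD; rewrite /slice mulr0 addr0 (WP_init0 hphi)//.
by rewrite /I_ mulr0 addr0.
Qed.

Local Notation be n := (freq P n * gamma_ v).

Lemma fourier_sqr_conserved n t : 0 <= t ->
  fourier_sqr L v (unfolded_pair L v (slice v phit t) (slice v phix t)) n =
  fourier_sqr L v (unfolded_pair L v phi1 dphi0) n.
Proof.
move=> t0; have [v0 v1] := andP v01.
have nv : 1 - v != 0 by rewrite subr_eq0 gt_eqF.
have beE : be n * (1 - v) = freq P n * (1 + v) by rewrite /gamma_; field.
have cosL : cos (freq P n * L) = - cos (be n * L).
  by rewrite (freq_L L0 v01) odd_pi_cos.
have sinL : sin (freq P n * L) = sin (be n * L).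
  by rewrite (freq_L L0 v01) odd_pi_sin.
have modeE s : 0 <= s ->
    fourier_sqr L v (unfolded_pair L v (slice v phit s) (slice v phix s)) n =
    mode_re L v phix phit (freq P n) (be n) s ^+ 2 +
    mode_im L v phix phit (freq P n) (be n) s ^+ 2.
  move=> s0; rewrite /fourier_sqr.
  by rewrite (integral_unfold_cos L0 v01 _ (L2t s0) (L2x s0)) (integral_unfold_sin L0 v01 _ (L2t s0) (L2x s0)).
rewrite modeE// (mode_conserved L0 hphi erefl beE cosL sinL t0).
rewrite /fourier_sqr (integral_unfold_cos L0 v01 _ hphi1 hdphi0) (integral_unfold_sin L0 v01 _ hphi1 hdphi0).
have ccos a : continuous (fun y : R => cos (a * y)) := C1_deriv_continuous (C1_deriv_cos_scaled a).
have csin a : continuous (fun y : R => sin (a * y)) := C1_deriv_continuous (C1_deriv_sin_scaled a).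
congr (_ ^+ 2 + _ ^+ 2).
- apply: initial_pairing.
  + by move=> y; apply: cvgD; exact: ccos.
  + exact: C1_deriv_sub (C1_deriv_cos_scaled _) (C1_deriv_cos_scaled _).
  + by rewrite !mulr0 subrr.
- apply: initial_pairing.
  + by move=> y; apply: cvgB; exact: csin.
  + exact: C1_deriv_add (C1_deriv_sin_scaled _) (C1_deriv_sin_scaled _).
  + by rewrite !mulr0 sin0 addr0.
Qed.

(** The squared norms of the unfolded data at time t and at time 0 have the same
Parseval expansion. *)
Lemma energy_initial t : 0 <= t ->
  energy L v phix phit t =
  ((1 + v) / 4 * \int[mu]_(x in `]0, P[) (unfolded_pair L v phi1 dphi0 x ^+ 2))%:E.
Proof.
move=> t0; rewrite (energy_unfold_pair L0 v01 (L2_phit hphi t0) (L2_phix hphi t0)).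
congr (_ * _)%:E; have P0 := L_2_gt0 L0 v01.
have hu f g : L2_on D f -> L2_on D g -> L2_on `]0, P[ (unfolded_pair L v f g).
  by move=> hf hg; apply: L2_on_unfold => //; [exact: L2_on_add|exact: L2_on_sub].
have h1 : 2 / P * \sum_(n < N) fourier_sqr L v
    (unfolded_pair L v (slice v phit t) (slice v phix t)) n @[N --> \oo] -->
    \int[mu]_(x in `]0, P[) (unfolded_pair L v (slice v phit t) (slice v phix t) x ^+ 2).
  by exact: (trig_parseval P0 (hu _ _ (L2t t0) (L2x t0))).
have h2 : 2 / P * \sum_(n < N) fourier_sqr L v (unfolded_pair L v phi1 dphi0) n @[N --> \oo] -->
    \int[mu]_(x in `]0, P[) (unfolded_pair L v phi1 dphi0 x ^+ 2).
  by exact: (trig_parseval P0 (hu _ _ hphi1 hdphi0)).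
have e N : 2 / P * \sum_(n < N) fourier_sqr L v
      (unfolded_pair L v (slice v phit t) (slice v phix t)) n =
    2 / P * \sum_(n < N) fourier_sqr L v (unfolded_pair L v phi1 dphi0) n.
  by congr (_ * _); apply: eq_bigr => n _; exact: fourier_sqr_conserved.
rewrite (funext e) in h1.
by rewrite -(cvg_lim (@Rhausdorff R) h1) -(cvg_lim (@Rhausdorff R) h2).
Qed.

End Conservation.

Unset Implicit Arguments.

Theorem theorem2 (R : realType) (L v : R) (hL : 0 < L) (hv : 0 <= v < 1)
    (phi0 dphi0 phi1 : R -> R)
    (hphi0 : H1_right 0 L phi0 dphi0) (hphi1 : L2_on `]0, L[ phi1)
    (phi phix phit : R -> R -> R)
    (hphi : WP_solution L v phi0 phi1 phi phix phit) :
  (forall t : R, 0 <= t ->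
     energy L v phix phit t =
     ((pi ^+ 2 * (1 - v ^+ 2) / (2 * L))%:E *
      \esum_(n in [set: int])
        (Normc.normc ((2 * n + 1)%:~R * coef L v dphi0 phi1 n) ^+ 2)%:E)%E) /\
  (forall s t : R, 0 <= s -> 0 <= t ->
     energy L v phix phit s = energy L v phix phit t).
Proof.
have hE := energy_initial hL hv hphi0 hphi1 hphi.
have hdphi0 : L2_on `]0, L[ dphi0 by case: hphi0 => -[].
split; last by move=> s t s0 t0; rewrite !hE.
by move=> t t0; rewrite hE// (esum_coef hL hv hdphi0 hphi1).
Qed.
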